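(* Let $T$ be a complete dependent theory with monster model $\mathfrak{C}$ and let $A\subseteq\mathfrak{C}$ be a (small) set. Let $I$ be a Morley sequence over $A$, and assume that $\mathrm{Ev}(I)=\mathrm{Av}(I,\mathfrak{C})$. Then $\mathrm{Av}(I,A)$ is generically stable, hence so is $\mathrm{Av}(I,\mathfrak{C})=\mathrm{Ev}(I)$, and $I$ is an indiscernible set.
   Context: Setting: $T$ is a complete theory (classical first-order, or continuous), $T=T^{eq}$, with monster model $\mathfrak{C}$. $T$ is dependent: for every indiscernible sequence $\langle a_i:i<\lambda\rangle$, every formula $\varphi(x,y)$ and every $c$, the limit $\lim_{i<\lambda}\varphi(a_i,c)$ of truth values exists (classically: the truth value is eventually constant). Conventions: all indiscernible sequences are indexed by infinite linear orders without a last element. An indiscernible sequence is an indiscernible set if the type of any $k$ distinct members depends only on $k$. For an indiscernible sequence $J=\langle a_i:i\in O\rangle$, $\lim_J\varphi(x,b)$ denotes the limit of the truth values $\varphi(a_i,b)$ as $i$ goes to the end of $O$; $\mathrm{Av}(J,B)$ is the complete type over $B$ giving each formula $\varphi(x,b)$ over $B$ the value $\lim_J\varphi(x,b)$. A Morley (nonforking) sequence over $A$ is an $A$-indiscernible sequence $\langle a_i:i\in O\rangle$ such that $\mathrm{tp}(a_i/Aa_{<i})$ does not fork over $A$ for all $i$; it is a Morley sequence in $p\in S(A)$ if moreover its members realize $p$. Eventual type. For $A$-indiscernible sequences $I,J$ (possibly of different order types), $I\equiv_{\mathrm{lstp},A}J$ means that some (equivalently, any) increasing subsequences of order type $\omega$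 of $I$ and of $J$ have the same Lascar strong type over $A$; $J$ continues $I$ over $A$ if $I^\frown J$ is $A$-indiscernible. An $A$-indiscernible $J$ eventually determines $\varphi(x,b)$ if $\lim_{J'}\varphi(x,b)$ takes the same value for all $J'$ continuing $J$ over $A$. If $I$ is a Morley sequence over $A$, then for each formula $\varphi(x,b)$ there is $J\equiv_{\mathrm{lstp},A}I$ which eventually determines $\varphi(x,b)$, and $\lim_J\varphi(x,b)$ does not depend on the choice of such $J$. $\mathrm{Ev}(I)$ is the global type (complete type over $\mathfrak{C}$) giving each $\varphi(x,b)$ this value. Generic stability. A type $p\in S(A)$ is extensible if it has a global extension not forking over $A$. $p$ is generically stable if there is a Morley sequence in $p$ (over $A$) which is an indiscernible set; equivalently (known), $p$ is extensible and every Morley sequence in $p$ is an indiscernible set. The same definition is used for global types (with the domain $\mathfrak{C}$ in place of $A$, realizations being taken in a larger monster model). *)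

(* Defs.v *)
From HB Require Import structures.
From mathcomp Require Import all_boot all_order all_algebra.
From mathcomp Require Import all_classical all_reals all_analysis.

Set Implicit Arguments.
Unset Strict Implicit.
Unset Printing Implicit Defensive.

Import Order.TTheory GRing.Theory Num.Theory.

Local Open Scope classical_set_scope.
Local Open Scope ring_scope.

(* Classical and continuous first-order logic are treated together. Truth
   values are real numbers in [0, 1], with 0 for "true" and 1 for "false".
   - [is_cont L = true]: continuous logic. Sorts are complete metric spaces of
     diameter at most 1, symbols are uniformly continuous, and the connectives
     are the usual complete system 1 - x, max(x - y, 0), x / 2.
   - [is_cont L = false]: classical logic. The metric of every sort is the
     discrete {0, 1}-valued one (so the formula d(t, u) is t = u), predicates
     are {0, 1}-valued, and the connective x / 2 is absent. Then 1 - x is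
     negation, max(x - y, 0) is the implication from y to x, and sup is the
     universal quantifier.
   The complete theory T is the theory of its monster model. *)
Record lang := Lang {
  lsort : Type;
  fnsym : Type;
  farity : fnsym -> nat;
  fdom : forall f, 'I_(farity f) -> lsort;
  fcod : fnsym -> lsort;
  prsym : Type;
  parity : prsym -> nat;
  pdom : forall P, 'I_(parity P) -> lsort;
  is_cont : bool }.

Section Syntax.
Variable L : lang.

(* A context: a family of sorted variables, of any size. A formula over a
   context still mentions only finitely many of them. *)
Record ctx := Ctx { var : Type; vsort : var -> lsort L }.

Definition ctx0 : ctx := @Ctx void (of_void _).

Definition csum (X Y : ctx) : ctx :=
  @Ctx (var X + var Y)
    (fun v => match v with inl x => vsort x | inr y => vsort y end).

Definition cext (X : ctx) (s : lsort L) : ctx :=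
  @Ctx (option (var X)) (fun v => if v is Some x then vsort x else s).

Definition crep (X : ctx) (I : Type) : ctx :=
  @Ctx (var X * I) (fun v => vsort v.1).

Definition fin_ctx (X : ctx) : Prop := finite_set [set: var X].

Inductive lterm (V : ctx) : lsort L -> Type :=
| tvar (v : var V) : lterm V (vsort v)
| tapp (f : fnsym L) : (forall i, lterm V (fdom (f := f) i)) -> lterm V (fcod f).

(* The infimum (existential) quantifier is 1 - sup (1 - _). *)
Inductive lform (V : ctx) : Type :=
| fdist (s : lsort L) of lterm V s & lterm V s
| fpred (P : prsym L) of (forall i, lterm V (pdom (P := P) i))
| fneg of lform V
| fmonus of lform V & lform V
| fhalf of is_cont L & lform V
| fsup (s : lsort L) of lform (cext V s).

End Syntax.

Arguments ctx0 {L}.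

Record struct (R : realType) (L : lang) := Struct {
  sdom : lsort L -> metricType R;
  dom_inh : forall s, inhabited (sdom s);
  dom_le1 : forall s (x y : sdom s), mdist x y <= 1;
  dom_complete : forall s (F : set_system (sdom s)),
    ProperFilter F -> cauchy F -> exists x : sdom s, F --> x;
  fint : forall f, (forall i, sdom (fdom (f := f) i)) -> sdom (fcod f);
  fint_unif : forall f (e : R), 0 < e -> exists2 d : R, 0 < d &
    forall x y, (forall i, mdist (x i) (y i) < d) ->
      mdist (fint (f := f) x) (fint y) < e;
  pint : forall P, (forall i, sdom (pdom (P := P) i)) -> R;
  pint_itv : forall P x, 0 <= pint (P := P) x <= 1;
  pint_unif : forall P (e : R), 0 < e -> exists2 d : R, 0 < d &
    forall x y, (forall i, mdist (x i) (y i) < d) ->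
      `|pint (P := P) x - pint y| < e;
  dist_classical : ~~ is_cont L -> forall s (x y : sdom s),
    mdist x y = 0 \/ mdist x y = 1;
  pint_classical : ~~ is_cont L -> forall P x,
    pint (P := P) x = 0 \/ pint x = 1 }.

Section Semantics.
Variables (R : realType) (L : lang) (M : struct R L).

Definition tup (V : ctx L) : Type := forall v : var V, sdom M (vsort v).

Definition tup0 : tup ctx0 := fun v => match v with end.

Definition tsum (X Y : ctx L) (a : tup X) (b : tup Y) : tup (csum X Y) :=
  fun v => match v with inl x => a x | inr y => b y end.

Definition text (X : ctx L) s (a : tup X) (c : sdom M s) : tup (cext X s) :=
  fun v => match v with Some x => a x | None => c end.

Definition block (X : ctx L) (O I : Type) (a : O -> tup X) (t : I -> O) :
  tup (crep X I) := fun v => a (t v.2) v.1.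

Fixpoint teval (V : ctx L) (a : tup V) s (t : lterm V s) : sdom M s :=
  match t with
  | tvar v => a v
  | tapp f u => fint (fun i => teval a (u i))
  end.

Fixpoint feval (V : ctx L) (phi : lform V) : tup V -> R :=
  match phi with
  | fdist s t u => fun a => mdist (teval a t) (teval a u)
  | fpred P u => fun a => pint (fun i => teval a (u i))
  | fneg p => fun a => 1 - feval p a
  | fmonus p q => fun a => Num.max (feval p a - feval q a) 0
  | fhalf _ p => fun a => feval p a / 2
  | fsup s p => fun a => sup (range (fun c : sdom M s => feval p (text a c)))
  end.

(* Parameters: all definitions below are "over" a family [c : tup P]; a set of
   elements is the family of its own members. *)
Definition elt : Type := {s : lsort L & sdom M s}.

Definition pctx (A : set elt) : ctx L :=
  @Ctx L {e : elt | A e} (fun e => projT1 (proj1_sig e)).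

Definition params (A : set elt) : tup (pctx A) :=
  fun e => projT2 (proj1_sig e).

Definition same_type (P : ctx L) (c : tup P) (V : ctx L) (u v : tup V) : Prop :=
  forall phi : lform (csum V P), feval phi (tsum u c) = feval phi (tsum v c).

Definition is_aut (g : forall s, sdom M s -> sdom M s) : Prop :=
  [/\ forall s, bijective (g s),
      forall s x y, mdist (g s x) (g s y) = mdist x y,
      forall f x, g _ (fint (f := f) x) = fint (fun i => g _ (x i))
    & forall P x, pint (P := P) (fun i => g _ (x i)) = pint x].

(* Definable predicates without parameters: uniform limits of formulas
   (classically, formulas). *)
Definition definable (V : ctx L) (f : tup V -> R) : Prop :=
  forall e : R, 0 < e ->
    exists phi : lform V, forall a, `|f a - feval phi a| <= e.

(* T = T^eq: every formula phi(x, y) has canonical parameters, uniformly in y,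
   which are elements of one sort. *)
Definition has_eq : Prop :=
  forall (X Y : ctx L) (phi : lform (csum X Y)), fin_ctx X -> fin_ctx Y ->
  exists (s : lsort L) (psi : tup (cext X s) -> R), definable psi /\
    forall b : tup Y, exists! c : sdom M s,
      forall a : tup X, psi (text a c) = feval phi (tsum a b).

End Semantics.

Arguments tup0 {R L M}.
Arguments params {R L M} A.

Definition elementary (R : realType) (L : lang) (M N : struct R L)
    (h : forall s, sdom M s -> sdom N s) : Prop :=
  forall (V : ctx L) (phi : lform V) (a : tup M V),
    feval phi (fun v => h _ (a v) : sdom N _) = feval phi a.

(* Cardinals are represented by types: |A| < |K|. *)
Definition small (K T : Type) (A : set T) : bool := ~~ ([set: K] #<= A)%card.

(* M is kappa-saturated and strongly kappa-homogeneous, where kappa = |K| is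
   an uncountable strong limit cardinal greater than |L|. A condition phi <= r is
   represented by the pair (phi, r). *)
Record monster (K : Type) (R : realType) (L : lang) (M : struct R L) : Prop :=
  Monster {
  mon_nat : small K [set: nat];
  mon_pow : forall B : set K, small K B -> small K [set C : set K | C `<=` B];
  mon_sort : small K [set: lsort L];
  mon_fnsym : small K [set: fnsym L];
  mon_prsym : small K [set: prsym L];
  mon_sat : forall (V P : ctx L) (c : tup M P) (G : set (lform (csum V P) * R)),
    small K [set: var V] -> small K [set: var P] ->
    (forall D, finite_set D -> D `<=` G ->
       exists u : tup M V, forall q, D q -> feval q.1 (tsum u c) <= q.2) ->
    exists u : tup M V, forall q, G q -> feval q.1 (tsum u c) <= q.2;
  mon_hom : forall (V : ctx L) (u v : tup M V), small K [set: var V] ->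
    same_type tup0 u v ->
    exists2 g, is_aut g & forall x, g _ (u x) = v x }.

(* Sequences indexed by a nonempty (hence infinite) linear order without a last
   element. *)
Record eseq (T : Type) := ESeq {
  disp : Order.disp_t;
  idx : orderType disp;
  elem :> idx -> T;
  idx_inh : inhabited idx;
  idx_nolast : forall i : idx, exists j : idx, (i < j)%O }.

Definition small_seq (K T : Type) (I : eseq T) : bool := small K [set: idx I].

Section Limits.
Variables (R : realType) (d : Order.disp_t) (O : orderType d).

Definition has_lim (f : O -> R) (r : R) : Prop :=
  forall e : R, 0 < e -> exists i, forall j, (i <= j)%O -> `|f j - r| < e.

(* 0 when there is no limit *)
Definition lim_end (f : O -> R) : R := xget 0 [set r | has_lim f r].

End Limits.

Section Indiscernibles.
Variables (R : realType) (L : lang) (M : struct R L).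

Definition increasing (I O : Type) (ltI : rel I) (ltO : rel O) (t : I -> O) :=
  forall i j, ltI i j -> ltO (t i) (t j).

Definition ord_lt (n : nat) : rel 'I_n := fun i j => (i < j)%N.

Definition idx_lt d (O : orderType d) : rel O := fun i j => (i < j)%O.

Definition indiscernible (P : ctx L) (c : tup M P) (X : ctx L) (O : Type)
    (lt : rel O) (a : O -> tup M X) : Prop :=
  forall n (t u : 'I_n -> O),
    increasing (@ord_lt n) lt t -> increasing (@ord_lt n) lt u ->
    same_type c (block a t) (block a u).

Definition indisc_seq (P : ctx L) (c : tup M P) (X : ctx L)
    (I : eseq (tup M X)) : Prop :=
  indiscernible c (@idx_lt _ (idx I)) I.

(* Types are over the empty set. *)
Definition indisc_set (X : ctx L) (I : eseq (tup M X)) : Prop :=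
  indisc_seq tup0 I /\
  forall n (t u : 'I_n -> idx I), injective t -> injective u ->
    same_type tup0 (block I t) (block I u).

(* The concatenation of two sequences. *)
Definition cat_lt (T : Type) (I J : eseq T) : rel (idx I + idx J) :=
  fun u v => match u, v with
  | inl i, inl j => (i < j)%O
  | inl _, inr _ => true
  | inr _, inl _ => false
  | inr i, inr j => (i < j)%O
  end.

Definition cat_elem (T : Type) (I J : eseq T) (u : idx I + idx J) : T :=
  match u with inl i => I i | inr j => J j end.

Definition continues (P : ctx L) (c : tup M P) (X : ctx L)
    (I J : eseq (tup M X)) : Prop :=
  indiscernible c (@cat_lt _ I J) (@cat_elem _ I J).

(* phi(x, b) <= r divides over c. *)
Definition divides (P : ctx L) (c : tup M P) (X Y : ctx L)
    (phi : lform (csum X Y)) (b : tup M Y) (r : R) : Prop :=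
  exists b_ : nat -> tup M Y,
    [/\ b_ 0%N = b, indiscernible c ltn b_
      & ~ exists x : tup M X, forall i, feval phi (tsum x (b_ i)) <= r].

(* tp(a / e) forks over c: it implies a finite disjunction of conditions
   phi_k(x, b_k) <= r_k each of which divides over c. *)
Definition forks (P : ctx L) (c : tup M P) (Q : ctx L) (e : tup M Q)
    (X : ctx L) (a : tup M X) : Prop :=
  exists (n : nat) (Y : 'I_n -> ctx L) (phi : forall k, lform (csum X (Y k)))
         (b : forall k, tup M (Y k)) (r : 'I_n -> R),
    [/\ forall k, fin_ctx (Y k),
        forall k, divides c (phi k) (b k) (r k)
      & forall a' : tup M X, same_type e a a' ->
          exists k, feval (phi k) (tsum a' (b k)) <= r k].

Definition morley (P : ctx L) (c : tup M P) (X : ctx L)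
    (I : eseq (tup M X)) : Prop :=
  indisc_seq c I /\
  forall i : idx I,
    ~ forks c (tsum c (block I (fun j : {j : idx I | (j < i)%O} => sval j)))
            (I i).

Definition realizes (P : ctx L) (c : tup M P) (X : ctx L)
    (p : lform (csum X P) -> R) (a : tup M X) : Prop :=
  forall phi, feval phi (tsum a c) = p phi.

(* The type over B is the map sending a formula over B to its value. *)
Definition Av (X : ctx L) (J : eseq (tup M X)) (B : set (elt M)) :
    lform (csum X (pctx B)) -> R :=
  fun phi => lim_end (fun i : idx J => feval phi (tsum (J i) (params B))).

End Indiscernibles.

Arguments Av {R L M X} J B phi.

Section Monster.
Variables (K : Type) (R : realType) (L : lang) (M : struct R L).

Definition dependent : Prop :=
  forall (X Y : ctx L) (I : eseq (tup M X)) (phi : lform (csum X Y))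
         (b : tup M Y),
    fin_ctx X -> fin_ctx Y -> small_seq K I -> indisc_seq tup0 I ->
    exists r, has_lim (fun i : idx I => feval phi (tsum (I i) b)) r.

Definition fixes (P : ctx L) (c : tup M P)
    (g : forall s, sdom M s -> sdom M s) : Prop :=
  forall x, g _ (c x) = c x.

(* A-invariant equivalence relation with a bounded number of classes *)
Definition bounded_invariant (P : ctx L) (c : tup M P) (V : ctx L)
    (E : tup M V -> tup M V -> Prop) : Prop :=
  [/\ forall u, E u u,
      forall u v, E u v -> E v u,
      forall u v w, E u v -> E v w -> E u w,
      forall g u v, is_aut g -> fixes c g -> E u v ->
        E (fun x => g _ (u x)) (fun x => g _ (v x))
    & exists2 S : set (tup M V), small K S &
        forall u, exists2 v, S v & E u v].

Definition same_lstp (P : ctx L) (c : tup M P) (V : ctx L) (u v : tup M V) :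
    Prop :=
  forall E, bounded_invariant c E -> E u v.

Definition seq_lstp (P : ctx L) (c : tup M P) (X : ctx L)
    (I J : eseq (tup M X)) : Prop :=
  exists (f : nat -> idx I) (g : nat -> idx J),
    [/\ increasing ltn (@idx_lt _ (idx I)) f,
        increasing ltn (@idx_lt _ (idx J)) g
      & same_lstp c (block I f) (block J g)].

Definition ev_determines (P : ctx L) (c : tup M P) (X : ctx L)
    (J : eseq (tup M X)) (Q : ctx L) (b : tup M Q) (phi : lform (csum X Q)) :
    Prop :=
  exists r, forall J' : eseq (tup M X), small_seq K J' -> continues c J J' ->
    has_lim (fun i : idx J' => feval phi (tsum (J' i) b)) r.

(* Global types are types over [set: elt M]; the value is well defined when I
   is a Morley sequence over A and T is dependent. *)
Definition Ev (A : set (elt M)) (X : ctx L) (I : eseq (tup M X)) :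
    lform (csum X (pctx [set: elt M])) -> R :=
  fun phi => xget 0 [set r | exists J : eseq (tup M X),
    [/\ small_seq K J, indisc_seq (params A) J,
        seq_lstp (params A) I J,
        ev_determines (params A) J (params [set: elt M]) phi
      & has_lim (fun i : idx J =>
          feval phi (tsum (J i) (params [set: elt M]))) r]].

(* p is a type over the small family c of elements of M. *)
Definition gen_stable (P : ctx L) (c : tup M P) (X : ctx L)
    (p : lform (csum X P) -> R) : Prop :=
  exists I : eseq (tup M X),
    [/\ small_seq K I, morley c I, forall i, realizes c p (I i)
      & indisc_set I].

End Monster.

Arguments Ev K {R L M} A {X} I phi.

(* Main.v *)
(* Let D = Av(I, M), and call "the I-type" the type over A of the increasing
   tuples of I. Let c be a finite increasing tuple of I^J, where J continues I
   over A. The hypothesis lets us compute the value of a formula phi(x, c) in D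
   in two ways.
   - D = Ev(I): some J' with the Lascar type of I eventually determines
     phi(x, c). Since I does not fork over A and T is dependent, there is a
     sequence e such that I^e is A-indiscernible and every A-indiscernible
     sequence from a given small set is indiscernible over A and e. Hence e
     continues both J' and I, and c behaves over e like a tuple of I, so that
     (c, x) takes the value prescribed by the I-type for x = e_k, hence for D.
   - D = Av(I): x may be taken in I, above the part of c lying in I but below
     the part lying in J.
   Therefore the I-type is unchanged when one entry of a tuple is moved to the
   end. These moves generate all permutations, and I is an indiscernible set.
   In a larger monster model, a coheir sequence of D over M, along an ultrafilter
   containing the tails of I, does not fork over M and is an indiscernible set
   because I is. *)
Require Import Defs.
From mathcomp Require Import all_boot all_order all_algebra.
From mathcomp Require Import all_classical all_reals all_analysis.
From mathcomp Require Import lra zify.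

Set Implicit Arguments.
Unset Strict Implicit.
Unset Printing Implicit Defensive.

Import Order.TTheory GRing.Theory Num.Theory.

Local Open Scope classical_set_scope.
Local Open Scope ring_scope.

(** * Cardinals below a strong limit *)

(** Lascar types enter through one consequence only: tuples of the same Lascar strong type over A
    are joined by finitely many steps, each given by an A-indiscernible sequence. This dictates the
    property asked of e. Once the sequences of these steps are put in the prescribed small set, each
    step preserves types over A and e, so the chosen subsequences of I and J' have the same type
    over A and e, and what continues I also continues J'. The order of choices matters: J' depends
    on the formula and on c, and e is chosen last, for a small set containing I, J, J' and the
    steps. Dependence is used twice. It makes a greedy choice of a continuation of I converge, which
    yields J'. It also shows that a realization of a type avoiding division over A cannot separate
    two terms of an A-indiscernible sequence, which yields e entry by entry. The nonforking and
    coheir extensions are represented by ultrafilters on tuples of the model, and new elements come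
    from realizing these, or filters of far-out subsequences, over small sets. *)

Definition embeds (T U : Type) : Prop := exists f : T -> U, injective f.

Lemma embeds_trans (T U V : Type) : embeds T U -> embeds U V -> embeds T V.
Proof. by move=> [f fi] [g gi]; exists (g \o f); apply: inj_comp. Qed.

(** A maximal partial bijection, given by Zorn's lemma, is total on one side; otherwise a pair of
    points outside it could be added. *)
Lemma embeds_total (T U : Type) : embeds T U \/ embeds U T.
Proof.
pose P (G : set (T * U)) := forall p q, G p -> G q -> (p.1 = q.1 <-> p.2 = q.2).
have [] := @Zorn_bigcup _ P.
  move=> F FP Ftot p q [G FG Gp] [H FH Hq].
  have [GH|HG] := Ftot _ _ FG FH.
    by apply: (FP _ FH) => //; exact: GH.
  by apply: (FP _ FG) => //; exact: HG.
move=> G [PG Gmax].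
have [tot|/existsNP[x xP]] := pselect (forall x, exists y, G (x, y)).
  have [f fP] := choice tot.
  by left; exists f => x x' e; apply: (PG _ _ (fP x) (fP x')).2 e.
have [tot|/existsNP[y yP]] := pselect (forall y, exists x, G (x, y)).
  have [f fP] := choice tot.
  by right; exists f => y y' e; apply: (PG _ _ (fP y) (fP y')).1 e.
exfalso; apply: (Gmax (G `|` [set (x, y)])).
  split; first by left.
  by move=> /(_ (x, y)) H; apply: xP; exists y; apply: H; right.
move=> [p1 p2] [q1 q2] [Gp|[-> ->]] [Gq|[-> ->]] //=.
- exact: (PG (p1, p2) (q1, q2)).
- by split=> e; exfalso; [apply: xP; exists p2|apply: yP; exists p1]; rewrite -e.
- by split=> e; exfalso; [apply: xP; exists q2|apply: yP; exists q1]; rewrite e.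
Qed.


Lemma card_leTE (T U : Type) : ([set: T] #<= [set: U])%card <-> embeds T U.
Proof.
split.
  case/card_leP => f.
  exists (fun x => val (f (to_setT x))) => x y /val_inj.
  by move/(@inj _ _ setT f); rewrite !inE => /(_ I I) /(congr1 val).
move=> [f fi]; apply/card_leP/injfunPex.
exists (fun x : [set: T] => to_setT (f (val x))) => // x y _ _ /(congr1 val) /= /fi.
exact: val_inj.
Qed.

Lemma smallP (K T : Type) : small K [set: T] <-> ~ embeds K T.
Proof. by rewrite -card_leTE /small; split => /negP. Qed.

Lemma small_setP (K T : Type) (A : set T) :
  small K A <-> ~ embeds K {x | A x}.
Proof.
rewrite -smallP /small.
suff e : ([set: {x | A x}] #= A)%card by rewrite (card_le_eqr e).
apply/card_eqPle; split; apply/card_leP/injfunPex.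
  exists (fun x : [set: {x | A x}] => SigSub (mem_set (proj2_sig (val x))) : A) => //.
  move=> x y _ _ /(congr1 val) /= e; apply: val_inj => /=.
  by case: (val x) (val y) e => [u Hu] [v Hv] /= e; apply: eq_exist.
exists (fun x : A => to_setT (exist _ (val x) (set_mem (valP x)) : {x | A x})) => //.
move=> x y _ _ /(congr1 val) /(congr1 (@proj1_sig _ _)) /= e.
exact: val_inj.
Qed.

Section Small.
Variables (K : Type).
Hypothesis Knat : small K [set: nat].
Hypothesis Kpow : forall B : set K, small K B -> small K [set C : set K | C `<=` B].

Local Notation sm T := (small K [set: T]).

Lemma small_embeds (T U : Type) : embeds T U -> sm U -> sm T.
Proof. by rewrite !smallP => TU H KT; apply: H; apply: embeds_trans KT TU. Qed.

Lemma small_surj (T U : Type) (f : T -> U) :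
  (forall y, exists x, f x = y) -> sm T -> sm U.
Proof.
move=> /choice[g gK]; apply: small_embeds; exists g.
exact: (can_inj gK).
Qed.

(** The strong limit hypothesis concerns subsets of [K]. Comparability embeds T in [K], because [K]
    does not embed in T, and subsets of T become subsets of the image. *)
Lemma small_set (T : Type) : sm T -> sm (set T).
Proof.
move=> sT; have [KT|[f fi]] := embeds_total K T; first by move/smallP: sT.
have sB : small K (range f).
  apply/small_setP => KB; move/smallP: sT; apply; apply: embeds_trans KB _.
  have H (z : {x | range f x}) : exists x, f x = sval z.
    by case: z => z /= [x _ <-]; exists x.
  have [g gP] := choice H; exists g => x y e.
  by apply: eq_sig_hprop => //; rewrite -!gP e.
have /small_setP := Kpow sB; rewrite smallP => H KT; apply: H.
apply: embeds_trans KT _.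
have H (S : set T) : f @` S `<=` range f by move=> _ [x _ <-]; exists x.
exists (fun S => exist (fun C => C `<=` range f) (f @` S) (H S)).
move=> S S' /(congr1 sval) /= e; apply/seteqP; split => x Sx.
  by have: (f @` S) (f x) by [exists x]; rewrite e => -[y S'y /fi <-].
by have: (f @` S') (f x) by [exists x]; rewrite -e => -[y S'y /fi <-].
Qed.

(* Kuratowski pairs. *)
Lemma small_sqr (T : Type) : sm T -> sm (T * T).
Proof.
move=> sT; apply: (@small_embeds _ (set (set T))); last by do 2!apply: small_set.
exists (fun p => [set [set p.1]; [set p.1; p.2]]) => -[a b] [c d] /= e.
have ac : a = c.
  have : [set [set a]; [set a; b]] [set c] by rewrite e; left.
  case=> e'.
    by have : [set c] c by []; rewrite e'.
  by have : [set a; b] a by [left]; rewrite -e'.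
subst c; congr pair.
have : [set [set a]; [set a; d]] [set a; b] by rewrite -e; right.
have : [set [set a]; [set a; b]] [set a; d] by rewrite e; right.
have d1 : [set a; d] d by right.
have b1 : [set a; b] b by right.
case=> e1; rewrite e1 in d1.
  by case=> e2; rewrite e2 in b1; [rewrite b1 d1|move: b1; rewrite e1 => ->].
by case: d1 => // -> [e2|e2]; move: b1; rewrite e2; [|case=> //; rewrite e1; case].
Qed.

Lemma small_prod (T U : Type) : sm T -> sm U -> sm (T * U).
Proof.
move=> sT sU; have [[f fi]|[f fi]] := embeds_total T U.
  apply: (small_embeds _ (small_sqr sU)).
  by exists (fun p => (f p.1, p.2)) => -[a b] [c d] [/fi -> ->].
apply: (small_embeds _ (small_sqr sT)).
by exists (fun p => (p.1, f p.2)) => -[a b] [c d] [-> /fi ->].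
Qed.

Lemma small_bool : sm bool.
Proof. by apply: (small_embeds _ Knat); exists nat_of_bool => -[] []. Qed.

Lemma small_sum (T U : Type) : sm T -> sm U -> sm (T + U).
Proof.
move=> sT sU; have [[f fi]|[f fi]] := embeds_total T U.
  apply: (small_embeds _ (small_prod small_bool sU)).
  exists (fun x => match x with inl t => (true, f t) | inr u => (false, u) end).
  by move=> [a|a] [b|b] // [] => [/fi|] ->.
apply: (small_embeds _ (small_prod small_bool sT)).
exists (fun x => match x with inr t => (true, f t) | inl u => (false, u) end).
by move=> [a|a] [b|b] // [] => [|/fi] ->.
Qed.

Lemma small_sig (T : Type) (P : T -> Prop) : sm T -> sm {x | P x}.
Proof.
by apply: small_embeds; exists sval => x y e; apply: eq_sig_hprop.
Qed.

Lemma small_ord n : sm 'I_n.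
Proof. by apply: (small_embeds _ Knat); exists val; apply: val_inj. Qed.

Lemma small_seqT (T : Type) : sm T -> sm (seq T).
Proof.
move=> sT; apply: (@small_embeds _ (set (nat * T))); last first.
  by apply: small_set; apply: small_prod.
exists (fun s => [set p | onth s p.1 = Some p.2]) => s s' e.
have {e} e i : onth s i = onth s' i.
  have H x : onth s i = Some x <-> onth s' i = Some x.
    by move: (congr1 (@^~ (i, x)) e) => /= ->.
  case E: (onth s i) => [x|]; first by move/H: E.
  by case E': (onth s' i) => [x|] //; move/H: E'; rewrite E.
elim: s s' e => [|x s IH] [|y s'] e //.
- by have := e 0%N.
- by have := e 0%N.
- by have [->] := e 0%N; congr cons; apply: IH => i; have := e i.+1.
Qed.

Lemma small_tree (T : Type) : sm T -> sm (GenTree.tree T).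
Proof.
move=> sT; apply: (@small_embeds _ (seq (nat + T))).
  by exists (@GenTree.encode T); apply: (pcan_inj (GenTree.codeK T)).
by apply: small_seqT; apply: small_sum.
Qed.

Lemma small_fin (T : Type) : finite_set [set: T] -> sm T.
Proof.
move=> /finite_set_countable; rewrite /countable card_leTE => H.
exact: small_embeds H Knat.
Qed.

Lemma small_setT (T : Type) (A : set T) : small K A <-> sm {x | A x}.
Proof. by rewrite smallP small_setP. Qed.

Lemma small_image (T U : Type) (f : T -> U) : sm T -> small K (range f).
Proof.
move=> sT; apply/small_setT.
apply: (@small_surj _ _ (fun x => exist (range f) (f x) (ex_intro2 _ _ x I erefl))) => //.
by case=> y yP; have [x _ e] := yP; exists x; apply: eq_exist.
Qed.

Lemma small_setU (T : Type) (A B : set T) : small K A -> small K B -> small K (A `|` B).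
Proof.
move=> /small_setT sA /small_setT sB; apply/small_setT.
apply: (small_embeds _ (small_sum sA sB)).
have H (z : {x | (A `|` B) x}) : exists w : {x | A x} + {x | B x},
   match w with inl w => sval w = sval z | inr w => sval w = sval z end.
  case: z => x [Ax|Bx]; first by exists (inl (exist _ x Ax)).
  by exists (inr (exist _ x Bx)).
have [f fP] := choice H; exists f => x y e.
move: (fP x) (fP y); rewrite e; case: (f y) => w -> /= e';
  by apply: eq_sig_hprop.
Qed.

Lemma small_sub (T : Type) (A B : set T) : A `<=` B -> small K B -> small K A.
Proof.
move=> AB /small_setT sB; apply/small_setT; apply: small_embeds sB.
exists (fun x => exist B (sval x) (AB _ (proj2_sig x))) => x y /(congr1 sval) /= e.
by apply: eq_sig_hprop.
Qed.

End Small.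

(** * Substitution and finite support *)

Section Substitution.
Variable L : lang.

Definition subst (V W : ctx L) : Type := forall v : var V, lterm W (vsort v).

Fixpoint tsub (V W : ctx L) (r : subst V W) s (t : lterm V s) : lterm W s :=
  match t with
  | tvar v => r v
  | tapp f u => tapp (fun i => tsub r (u i))
  end.

Definition weaken (W : ctx L) (s : lsort L) : subst W (cext W s) :=
  fun w => @tvar L (cext W s) (Some w).

Definition lift_sub (V W : ctx L) (s : lsort L) (r : subst V W) :
    subst (cext V s) (cext W s) :=
  fun v => match v return lterm (cext W s) (vsort (c := cext V s) v) with
           | Some x => tsub (weaken s) (r x)
           | None => @tvar L (cext W s) None
           end.

Fixpoint fsub (V : ctx L) (phi : lform V) :
    forall W : ctx L, subst V W -> lform W :=
  match phi with
  | fdist s t u => fun W r => fdist (tsub r t) (tsub r u)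
  | fpred P u => fun W r => fpred (fun i => tsub r (u i))
  | fneg p => fun W r => fneg (fsub p r)
  | fmonus p q => fun W r => fmonus (fsub p r) (fsub q r)
  | fhalf h p => fun W r => fhalf h (fsub p r)
  | fsup s p => fun W r => fsup (fsub p (@lift_sub _ _ s r))
  end.

End Substitution.

Section SubstEval.
Variables (R : realType) (L : lang) (M : struct R L).

Lemma teval_sub (V W : ctx L) (r : subst V W) s (t : lterm V s) (a : tup M W) :
  teval a (tsub r t) = teval (fun v => teval a (r v)) t.
Proof.
elim: t => //= f u IH; congr fint.
by apply/functional_extensionality_dep => i; apply: IH.
Qed.

Lemma feval_sub (V : ctx L) (phi : lform V) (W : ctx L) (r : subst V W) (a : tup M W) :
  feval (fsub phi r) a = feval phi (fun v => teval a (r v)).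
Proof.
elim: phi W r a => {V} /= [V s t u|V P u|V p IH|V p IHp q IHq|V h p IH|V s p IH] W r a.
- by rewrite !teval_sub.
- by congr pint; apply/functional_extensionality_dep => i; rewrite teval_sub.
- by rewrite IH.
- by rewrite IHp IHq.
- by rewrite IH.
- congr sup; apply: eq_imagel => c _; rewrite IH; congr feval.
  by apply/functional_extensionality_dep => -[v|//] /=; rewrite teval_sub.
Qed.

Lemma feval01 (V : ctx L) (phi : lform V) (a : tup M V) : 0 <= feval phi a <= 1.
Proof.
elim: phi a => {V} /= [V s t u|V P u|V p IH|V p IHp q IHq|V h p IH|V s p IH] a.
- by rewrite mdist_ge0 dom_le1.
- exact: pint_itv.
- by have := IH a; lra.
- have := IHp a; have := IHq a => /andP[q0 _] /andP[_ p1].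
  by rewrite le_max lexx orbT ge_max ler01 andbT; lra.
- by have := IH a; lra.
- have [c] := dom_inh M s; set S := image _ _.
  have nS : S !=set0 by exists (feval p (text a c)), c.
  have uS : ubound S 1 by move=> _ [x _ <-]; case/andP: (IH (text a x)).
  rewrite ge_sup// andbT; apply: le_trans (ub_le_sup _ _).
  + by have /andP[] := IH (text a c); move=> + _; apply.
  + by exists 1.
  + by exists c.
Qed.

(** Formulas with parameters are handled through their values as functions of the free variables;
    the existential absorbs changes of syntax and of context. *)
Definition cform (P : ctx L) (c : tup M P) (V : ctx L) (f : tup M V -> R) : Prop :=
  exists phi : lform (csum V P), forall x, f x = feval phi (tsum x c).

Lemma cform_comp (P : ctx L) (c : tup M P) (V W : ctx L) (phi : lform W)
    (G : tup M V -> tup M W) :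
  (forall w, exists t : lterm (csum V P) (vsort w),
     forall x, G x w = teval (tsum x c) t) ->
  cform c (fun x => feval phi (G x)).
Proof.
move=> H; have [r rP] : {r : subst W (csum V P) &
    forall w x, G x w = teval (tsum x c) (r w)}.
  exists (fun w => sval (cid (H w))) => w x.
  by case: (cid (H w)).
exists (fsub phi r) => x; rewrite feval_sub; congr feval.
by apply/functional_extensionality_dep => w; apply: rP.
Qed.

Lemma cform_neg (P : ctx L) (c : tup M P) (V : ctx L) (f : tup M V -> R) :
  cform c f -> cform c (fun x => 1 - f x).
Proof. by move=> [p pP]; exists (fneg p) => x; rewrite pP. Qed.

(* The tuples (u', c') and (v', c') are obtained from (u, c) and (v, c) by the same
   terms. *)
Lemma same_type_sub (P P' : ctx L) (c : tup M P) (c' : tup M P') (V V' : ctx L)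
    (u v : tup M V) (u' v' : tup M V') :
  same_type c u v ->
  (forall x, exists t : lterm (csum V P) (vsort x),
     u' x = teval (tsum u c) t /\ v' x = teval (tsum v c) t) ->
  (forall p, exists t : lterm (csum V P) (vsort p),
     c' p = teval (tsum u c) t /\ c' p = teval (tsum v c) t) ->
  same_type c' u' v'.
Proof.
move=> uv Hx Hp phi.
pose r : subst (csum V' P') (csum V P) := fun w =>
  match w return lterm (csum V P) (vsort (c := csum V' P') w) with
  | inl x => sval (cid (Hx x)) | inr p => sval (cid (Hp p)) end.
have := uv (fsub phi r); rewrite !feval_sub.
suff [-> ->] : (fun w => teval (tsum u c) (r w)) = tsum u' c' /\
  (fun w => teval (tsum v c) (r w)) = tsum v' c' by [].
split; apply/functional_extensionality_dep => -[x|p] /=.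
- by case: (cid (Hx x)) => t [/= ].
- by case: (cid (Hp p)) => t [/= ].
- by case: (cid (Hx x)) => t [/= ].
- by case: (cid (Hp p)) => t [/= ].
Qed.

Lemma same_type_refl (P : ctx L) (c : tup M P) (V : ctx L) (u : tup M V) :
  same_type c u u.
Proof. by []. Qed.

Lemma same_type_sym (P : ctx L) (c : tup M P) (V : ctx L) (u v : tup M V) :
  same_type c u v -> same_type c v u.
Proof. by move=> H phi; rewrite H. Qed.

Lemma same_type_trans (P : ctx L) (c : tup M P) (V : ctx L) (u v w : tup M V) :
  same_type c u v -> same_type c v w -> same_type c u w.
Proof. by move=> H H' phi; rewrite H H'. Qed.

End SubstEval.

Section FiniteSupport.
Variables (R : realType) (L : lang) (M : struct R L).

Definition rstr (V : ctx L) (F : set (var V)) : ctx L :=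
  @Ctx L {v | F v} (fun v => vsort (sval v)).

Definition tres (V : ctx L) (F : set (var V)) (a : tup M V) : tup M (rstr F) :=
  fun v => a (sval v).
Arguments tres {V} F a.

Lemma fin_rstr (V : ctx L) (F : set (var V)) : finite_set F -> fin_ctx (rstr F).
Proof.
move=> fF; rewrite /fin_ctx /=.
have : ([set: {v | F v}] #<= F)%card.
  apply/card_leP/injfunPex.
  exists (fun x : [set: {v | F v}] => SigSub (mem_set (proj2_sig (val x))) : F) => //.
  move=> x y _ _ /(congr1 val) /= e; apply: val_inj => /=.
  by case: (val x) (val y) e => [u Hu] [v Hv] /= e; apply: eq_exist.
by move/card_le_finite; apply.
Qed.

(** All larger F' are included so that the supports of several subterms can be merged by a union. *)
Lemma term_support (V : ctx L) s (t : lterm V s) :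
  exists2 F : set (var V), finite_set F & forall F', F `<=` F' ->
    exists t' : lterm (rstr F') s, forall a : tup M V, teval (tres F' a) t' = teval a t.
Proof.
elim: t => [v|f u IH].
  exists [set v]; first exact: finite_set1.
  move=> F' /(_ v erefl) Fv.
  by exists (@tvar L (rstr F') (exist _ v Fv)).
have H i : exists F : set (var V), finite_set F /\ forall F', F `<=` F' ->
    exists t' : lterm (rstr F') _, forall a : tup M V,
      teval (tres F' a) t' = teval a (u i).
  by have [F fF FP] := IH i; exists F.
have [F FP] := choice H; exists (\bigcup_i F i).
  by apply: bigcup_finite => // i _; case: (FP i).
move=> F' FF'.
have H' i : exists t' : lterm (rstr F') _, forall a : tup M V,
      teval (tres F' a) t' = teval a (u i).
  by have [_ H1] := FP i; apply: H1; apply: subset_trans FF' => x Fx; exists i.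
exists (tapp (fun i => sval (cid (H' i)))) => a /=; congr fint.
by apply/functional_extensionality_dep => i; case: (cid (H' i)).
Qed.

Lemma form_support (V : ctx L) (phi : lform V) :
  exists2 F : set (var V), finite_set F & forall F', F `<=` F' ->
    exists phi' : lform (rstr F'), forall a : tup M V,
      feval phi' (tres F' a) = feval phi a.
Proof.
elim: phi => {V} [V s t u|V P u|V p IH|V p [F fF IHp] q [G fG IHq]|V h p IH|V s p [F fF IH]].
- have [F fF FP] := term_support t; have [G fG GP] := term_support u.
  exists (F `|` G); first by rewrite finite_setU.
  move=> F' FGF'; have [t' t'P] := FP F' (subset_trans (@subsetUl _ _ _) FGF').
  have [u' u'P] := GP F' (subset_trans (@subsetUr _ _ _) FGF').
  by exists (fdist t' u') => a /=; rewrite t'P u'P.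
- have H i : exists F : set (var V), finite_set F /\ forall F', F `<=` F' ->
      exists t' : lterm (rstr F') _, forall a : tup M V,
        teval (tres F' a) t' = teval a (u i).
    by have [F fF FP] := term_support (u i); exists F.
  have [F FP] := choice H; exists (\bigcup_i F i).
    by apply: bigcup_finite => // i _; case: (FP i).
  move=> F' FF'.
  have H' i : exists t' : lterm (rstr F') _, forall a : tup M V,
        teval (tres F' a) t' = teval a (u i).
    by have [_ H1] := FP i; apply: H1; apply: subset_trans FF' => x Fx; exists i.
  exists (fpred (fun i => sval (cid (H' i)))) => a /=; congr pint.
  by apply/functional_extensionality_dep => i; case: (cid (H' i)).
- have [F fF FP] := IH; exists F => // F' /FP[p' p'P].
  by exists (fneg p') => a /=; rewrite p'P.
- exists (F `|` G); first by rewrite finite_setU.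
  move=> F' FGF'; have [p' p'P] := IHp F' (subset_trans (@subsetUl _ _ _) FGF').
  have [q' q'P] := IHq F' (subset_trans (@subsetUr _ _ _) FGF').
  by exists (fmonus p' q') => a /=; rewrite p'P q'P.
- have [F fF FP] := IH; exists F => // F' /FP[p' p'P].
  by exists (fhalf h p') => a /=; rewrite p'P.
- exists [set v | F (Some v)].
    by apply: finite_preimage => // x y _ _ [].
  move=> F' FF'.
  (* The bound variable [None] is always kept, whether or not it occurs in p, so that F'' is a
     context extended by one variable. *)
  pose F'' : set (var (cext V s)) := fun o => if o is Some v then F' v else True.
  have [p' p'P] : exists phi' : lform (rstr F''), forall a : tup M (cext V s),
      feval phi' (tres F'' a) = feval p a.
    by apply: IH => -[v|//]; exact: FF'.
  pose r : subst (rstr F'') (cext (rstr F') s) := fun o =>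
    match o return lterm (cext (rstr F') s) (vsort (c := rstr F'') o) with
    | exist (Some v) Fv => @tvar L (cext (rstr F') s) (Some (exist _ v Fv))
    | exist None _ => @tvar L (cext (rstr F') s) None
    end.
  exists (fsup (fsub p' r)) => a /=; congr sup; apply: eq_imagel => c _.
  rewrite feval_sub -p'P; congr feval.
  by apply/functional_extensionality_dep => -[[v|] Fv].
Qed.

End FiniteSupport.
Arguments tres {R L M V} F a.

(** Dependent choice for a sequence built entry by entry. The first hypothesis says that [P n e]
    constrains the entries below n only, so at stage n the later entries of e are arbitrary. *)
Lemma dep_choice_nat (T : Type) (P : nat -> (nat -> T) -> Prop) :
  (forall n e e', (forall k, (k < n)%N -> e k = e' k) -> P n e -> P n e') ->
  (exists e, P 0%N e) ->
  (forall n e, P n e -> exists x, P n.+1 (fun k => if k == n then x else e k)) ->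
  exists e, forall n, P n e.
Proof.
move=> Pext [e0 Pe0] Pstep.
have H (ne : nat * (nat -> T)) : exists x, P ne.1 ne.2 ->
    P ne.1.+1 (fun k => if k == ne.1 then x else ne.2 k).
  case: ne => n e; have [/Pstep[x Px]|nP] := pselect (P n e); first by exists x.
  by exists (e0 0%N).
have [f fP] := choice H.
pose st := fix st n := if n is n'.+1 then
  (fun k => if k == n' then f (n', st n') else st n' k) else e0.
have Pst n : P n (st n) by elim: n => //= n IH; exact: (fP (n, st n)).
have stE n m k : (k < n)%N -> st (n + m)%N k = st n k.
  move=> kn; elim: m => [|m IH]; first by rewrite addn0.
  by rewrite addnS /= ifN ?IH//; apply/eqP; lia.
exists (fun k => st k.+1 k) => n; apply: Pext (Pst n) => k kn.
by have := stE k.+1 (n - k.+1)%N k (ltnSn k); rewrite subnKC.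
Qed.

Lemma eqr_eps (R : realType) (a b : R) : (forall e, 0 < e -> `|a - b| < e) -> a = b.
Proof.
move=> H; apply/eqP; rewrite -subr_eq0 -normr_le0 leNgt; apply/negP => /H.
by rewrite ltxx.
Qed.

Lemma filter_finite (T I : Type) (F : set_system T) (D : set I) (f : I -> set T) :
  Filter F -> finite_set D -> (forall i, D i -> F (f i)) -> F (\bigcap_(i in D) f i).
Proof.
elim/Pchoice: I => I in D f *.
move=> FF /finite_fsetP[X ->] H; apply: filter_bigI => i iX; exact: H.
Qed.

(** * Types of sequences *)

Section StrictTotal.

(** Orders are bare relations here because index types, their initial segments, finite ordinals, nat
    and sums of these are mixed freely. *)
Definition stot (O : Type) (lt : rel O) : Prop :=
  [/\ irreflexive lt, transitive lt & forall x y, [\/ x = y, lt x y | lt y x]].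

Definition no_last (O : Type) (lt : rel O) : Prop := forall x, exists y, lt x y.

Definition suml (O O' : Type) (lt : rel O) (lt' : rel O') : rel (O + O') :=
  fun u v => match u, v with
  | inl i, inl j => lt i j
  | inl _, inr _ => true
  | inr _, inl _ => false
  | inr i, inr j => lt' i j
  end.

Definition sumf (O O' T : Type) (a : O -> T) (b : O' -> T) (u : O + O') : T :=
  match u with inl i => a i | inr j => b j end.

Lemma stot_idx d (O : orderType d) : stot (@idx_lt d O).
Proof.
split=> [x|y x z|x y]; rewrite /idx_lt ?ltxx//; first exact: lt_trans.
by case: (ltgtP x y) => [||->]; [constructor 2|constructor 3|constructor 1].
Qed.

Lemma stot_ltn : stot ltn.
Proof.
split=> [x|y x z|x y] /=; [exact: ltnn|exact: ltn_trans|].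
by case: (ltngtP x y) => [||->]; [constructor 2|constructor 3|constructor 1].
Qed.

Lemma stot_ord n : stot (@ord_lt n).
Proof.
split=> [x|y x z|x y]; rewrite /ord_lt; [exact: ltnn|exact: ltn_trans|].
by case: (ltngtP x y) => [||/val_inj->]; [constructor 2|constructor 3|constructor 1].
Qed.

Lemma stot_suml (O O' : Type) (lt : rel O) (lt' : rel O') :
  stot lt -> stot lt' -> stot (suml lt lt').
Proof.
move=> [i1 t1 l1] [i2 t2 l2]; split.
- by move=> [x|x] /=.
- by move=> [y|y] [x|x] [z|z] //=; [exact: t1|exact: t2].
- move=> [x|x] [y|y] /=; try by [constructor 2|constructor 3].
  + by case: (l1 x y) => [->||]; [constructor 1|constructor 2|constructor 3].
  + by case: (l2 x y) => [->||]; [constructor 1|constructor 2|constructor 3].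
Qed.

Lemma stot_inj_inc (I O : Type) (ltI : rel I) (lt : rel O) (t : I -> O) :
  stot ltI -> stot lt -> increasing ltI lt t -> forall i j, lt (t i) (t j) = ltI i j.
Proof.
move=> [i1 t1 l1] [i2 t2 l2] inc i j; apply/idP/idP; last exact: inc.
case: (l1 i j) => [->|//|/inc h h']; first by rewrite i2.
by have := t2 _ _ _ h h'; rewrite i2.
Qed.

Lemma fin_sorted (O : Type) (lt : rel O) (S : set O) : stot lt -> finite_set S ->
  exists n (o : 'I_n -> O), [/\ increasing (@ord_lt n) lt o,
    forall x, S x -> exists i, o i = x & forall i, S (o i)].
Proof.
elim/Peq: O => O in lt S *.
move=> [irr tr tot] /finite_seqP[s ->].
pose le x y := (x == y) || lt x y.
have le_tr : transitive le.
  move=> y x z /orP[/eqP->//|xy] /orP[/eqP<-|yz]; first by rewrite /le xy orbT.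
  by rewrite /le (tr _ _ _ xy yz) orbT.
have le_tot : total le.
  by move=> x y; rewrite /le; case: (tot x y) => [->|->|->]; rewrite ?eqxx ?orbT.
have le_refl : reflexive le by move=> x; rewrite /le eqxx.
pose s' := sort le (undup s).
have us' : uniq s' by rewrite sort_uniq undup_uniq.
have ms' : s' =i s by move=> x; rewrite mem_sort mem_undup.
exists (size s'), (fun i => tnth (in_tuple s') i); split.
- move=> i j ij.
  pose x0 : O := tnth (in_tuple s') i.
  rewrite !(tnth_nth x0) /=.
  have := @sorted_leq_nth _ _ le_tr le_refl x0 _ (sort_sorted le_tot (undup s)) i j.
  rewrite !inE !ltn_ord => /(_ isT isT (ltnW ij)) /orP[|//].
  by rewrite nth_uniq// => /eqP e; move: ij; rewrite /ord_lt e ltnn.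
- move=> x xs; have xs' : x \in s' by rewrite ms'.
  by have /tnthP[i ->] : x \in in_tuple s' by []; exists i.
- by move=> i /=; rewrite -ms' mem_tnth.
Qed.

Section NoLast.
Variables (O : Type) (lt : rel O).
Hypotheses (ltO : stot lt) (nlO : no_last lt) (iO : inhabited O).

Lemma ub_fin n (t : 'I_n -> O) : exists o, forall i, lt (t i) o.
Proof.
have [_ tr tot] := ltO; case: iO => o0.
elim: n t => [|n IH] t; first by exists o0 => -[].
have [ub ubP] := IH (fun i => t (lift ord0 i)).
have [w wP] : exists w, lt ub w /\ lt (t ord0) w.
  have [y oy] := nlO ub; have [z tz] := nlO (t ord0).
  case: (tot y z) => [e|yz|zy].
  - by exists y; split => //; rewrite e.
  - by exists z; split => //; exact: tr oy yz.
  - by exists y; split => //; exact: tr tz zy.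
by exists w => i; case: (unliftP ord0 i) => [j|] ->; [apply: tr (ubP j) _|]; apply wP.
Qed.

Lemma inc_above o : exists s : nat -> O, increasing ltn lt s /\ forall k, lt o (s k).
Proof.
have [_ tr tot] := ltO.
have [f fP] := choice nlO.
have inc1 k : lt (iter k.+1 f o) (iter k.+2 f o) by rewrite [X in lt _ X]iterS; exact: fP.
exists (fun k => iter k.+1 f o); split.
  move=> i j /= ij; rewrite -(subnKC ij); elim: (j - i.+1)%N => [|m IH].
    by rewrite addn0; exact: inc1.
  rewrite addnS; move: IH (inc1 (i.+1+m)%N). exact: tr.
by elim=> [|k IH]; [exact: fP|exact: (tr _ _ _ IH (inc1 k))].
Qed.

Lemma inc_from o : exists s : nat -> O, increasing ltn lt s /\ s 0%N = o.
Proof.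
have [s [s1 s2]] := inc_above o; exists (fun k => if k is k'.+1 then s k' else o).
by split => // -[|i] [|j] //= ij; apply: s1.
Qed.

Lemma inc_above_fin n (t : 'I_n -> O) :
  exists s : nat -> O, increasing ltn lt s /\ forall i k, lt (t i) (s k).
Proof.
have [ub ubP] := ub_fin t; have [s [s1 s2]] := inc_above ub.
by exists s; split => // i k; case: ltO => _ tr _; apply: tr (ubP i) (s2 k).
Qed.

Lemma inc_ord n : exists t : 'I_n -> O, increasing (@ord_lt n) lt t.
Proof.
case: iO => o; have [s [s1 s2]] := inc_above o.
by exists (fun i : 'I_n => s i) => i j ij; apply: s1.
Qed.

End NoLast.

End StrictTotal.

Section Sequences.
Variables (R : realType) (L : lang) (M : struct R L).

(** A formula mentions finitely many variables, so u and v need only be compared on finite sets F;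
    there the comparison may go through auxiliary tuples of any shape. *)
Lemma same_type_fin (P : ctx L) (c : tup M P) (V : ctx L) (u v : tup M V) :
  (forall F : set (var V), finite_set F -> exists (V' : ctx L) (u' v' : tup M V'),
     same_type c u' v' /\ forall x, F x -> exists t : lterm (csum V' P) (vsort x),
       u x = teval (tsum u' c) t /\ v x = teval (tsum v' c) t) ->
  same_type c u v.
Proof.
move=> H phi; have [F fF /(_ F (@subset_refl _ _))[phi' phi'P]] := form_support M phi.
have fF' : finite_set [set x | F (inl x)].
  by apply: finite_preimage => // x y _ _ [].
have [V' [u' [v' [uv' /= H']]]] := H _ fF'.
rewrite -!phi'P.
have Hr (w : var (rstr F)) : exists t : lterm (csum V' P) (vsort w),
   tsum u c (sval w) = teval (tsum u' c) t /\ tsum v c (sval w) = teval (tsum v' c) t.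
  case: w => -[x|p] Fw; first exact: H'.
  by exists (@tvar L (csum V' P) (inr p)).
pose r : subst (rstr F) (csum V' P) := fun w => sval (cid (Hr w)).
have := uv' (fsub phi' r); rewrite !feval_sub.
suff [-> ->] : (fun w => teval (tsum u' c) (r w)) = tres F (tsum u c) /\
  (fun w => teval (tsum v' c) (r w)) = tres F (tsum v c) by [].
by split; apply/functional_extensionality_dep => w;
  rewrite /r /tres; case: (cid (Hr w)) => t [].
Qed.

(** Equality of Ehrenfeucht-Mostowski types over c. As t and t' vary independently, it also forces
    indiscernibility of one side as soon as the other has increasing tuples of every length. *)
Definition like (P : ctx L) (c : tup M P) (X : ctx L)
    (O : Type) (lt : rel O) (a : O -> tup M X)
    (O' : Type) (lt' : rel O') (a' : O' -> tup M X) : Prop :=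
  forall n (t : 'I_n -> O) (t' : 'I_n -> O'),
    increasing (@ord_lt n) lt t -> increasing (@ord_lt n) lt' t' ->
    same_type c (block a t) (block a' t').

(** Repetitions are allowed: the distinct values of a finite part of t are sorted, and each is
    represented by one index z. *)
Lemma like_pattern (P : ctx L) (c : tup M P) (X : ctx L)
    (O : Type) (lt : rel O) (a : O -> tup M X)
    (O' : Type) (lt' : rel O') (a' : O' -> tup M X)
    (Z : Type) (t : Z -> O) (t' : Z -> O') :
  stot lt -> stot lt' -> like c lt a lt' a' ->
  (forall z z', lt (t z) (t z') = lt' (t' z) (t' z')) ->
  same_type c (block a t) (block a' t').
Proof.
move=> lto lto' H patt; apply: same_type_fin => F fF.
pose S := [set z | exists x, F (x, z)].
have fS : finite_set S.
  suff -> : S = snd @` F by apply: finite_image.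
  by apply/seteqP; split=> [z [x Fxz]|_ [[x z] Fxz <-]]; [exists (x, z)|exists x].
have [n [r [rinc rS Sr]]] := fin_sorted lto (finite_image t fS).
have Hz i : exists z, t z = r i by have [z _ <-] := Sr i; exists z.
have [z zP] := choice Hz.
exists (crep X 'I_n), (block a (t \o z)), (block a' (t' \o z)); split.
  by apply: H => i j ij /=; rewrite -?patt !zP; exact: rinc.
move=> [x s] Fxs; have [i ri] : exists i, r i = t s.
  by apply: rS; exists s => //; exists x.
exists (@tvar L (csum (crep X 'I_n) P) (inl (x, i))) => /=.
rewrite /block /= zP ri; split => //.
(* Indices with equal values under t have equal values under t', by trichotomy and the equality of
   patterns. *)
suff -> : t' (z i) = t' s by [].
case: lto' lto => i' _ tot' [irr _ _].
by case: (tot' (t' (z i)) (t' s)) => //; rewrite -patt zP ri irr.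
Qed.

Lemma like_indiscernible (P : ctx L) (c : tup M P) (X : ctx L)
    (O : Type) (lt : rel O) (a : O -> tup M X)
    (O' : Type) (lt' : rel O') (a' : O' -> tup M X) :
  stot lt' -> no_last lt' -> inhabited O' ->
  like c lt a lt' a' -> indiscernible c lt a.
Proof.
move=> lto' nl iO H n t u it iu; have [s si] := inc_ord lto' nl iO n.
by apply: same_type_trans (H _ _ _ it si) _; apply/same_type_sym/H.
Qed.

Lemma indisc_pattern (P : ctx L) (c : tup M P) (X : ctx L)
    (O : Type) (lt : rel O) (a : O -> tup M X) (Z : Type) (t t' : Z -> O) :
  stot lt -> indiscernible c lt a ->
  (forall z z', lt (t z) (t z') = lt (t' z) (t' z')) ->
  same_type c (block a t) (block a t').
Proof. by move=> lto H; apply: like_pattern. Qed.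

Lemma indisc_comp (P : ctx L) (c : tup M P) (X : ctx L)
    (O : Type) (lt : rel O) (a : O -> tup M X) (O' : Type) (lt' : rel O') (p : O' -> O) :
  increasing lt' lt p -> indiscernible c lt a -> indiscernible c lt' (a \o p).
Proof.
by move=> ip H n t u it iu; apply: (H n (p \o t) (p \o u)) => i j ij; apply: ip;
  [apply: it|apply: iu].
Qed.

Lemma indisc_blocks (P : ctx L) (c : tup M P) (X : ctx L)
    (O : Type) (lt : rel O) (a : O -> tup M X) (Z : Type) (p : nat -> Z -> O) :
  stot lt -> indiscernible c lt a ->
  (forall i j z z', lt (p i z) (p i z') = lt (p j z) (p j z')) ->
  (forall i j z z', (i < j)%N -> lt (p i z) (p j z')) ->
  indiscernible c ltn (fun i => block a (p i)).
Proof.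
move=> lto H patt inc n t u it iu.
have lt1 i j z z' : (i < j)%N -> lt (p j z) (p i z') = false.
  move=> ij; case: lto => irr tr _; apply/negP => h.
  by have := tr _ _ _ h (inc i j z' z ij); rewrite irr.
have patt' : forall w w' : Z * 'I_n,
    lt (p (t w.2) w.1) (p (t w'.2) w'.1) = lt (p (u w.2) w.1) (p (u w'.2) w'.1).
  move=> [z i] [z' i'] /=.
  case: (ltngtP i i') => [ii'|ii'|/val_inj <-].
  - by rewrite !inc//; [exact: iu|exact: it].
  - by rewrite !lt1//; [exact: iu|exact: it].
  - exact: patt.
have := indisc_pattern lto H patt'.
move=> /same_type_sub; apply; last by move=> q; exists (@tvar L (csum _ P) (inr q)).
by move=> [[x z] i]; exists (@tvar L (csum (crep X (Z * 'I_n)) P) (inl (x, (z, i)))).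
Qed.

End Sequences.

Section SetParameters.
Variables (R : realType) (L : lang) (M : struct R L).

Definition within (B : set (elt M)) (V : ctx L) (u : tup M V) : Prop :=
  forall v, B (existT _ (vsort v) (u v)).

Definition comps (V : ctx L) (u : tup M V) : set (elt M) :=
  range (fun v => existT _ (vsort v) (u v) : elt M).

Lemma withinS (B B' : set (elt M)) (V : ctx L) (u : tup M V) :
  B `<=` B' -> within B u -> within B' u.
Proof. by move=> BB' Bu v; apply: BB'. Qed.

Definition pvar (V : ctx L) (B : set (elt M)) s (b : sdom M s)
    (Hb : B (existT _ s b)) : lterm (csum V (pctx B)) s :=
  @tvar L (csum V (pctx B)) (inr (exist _ (existT _ s b : elt M) Hb)).

Lemma cform_set (B : set (elt M)) (V W : ctx L) (phi : lform W)
    (G : tup M V -> tup M W) :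
  (forall w, (exists t : lterm V (vsort w), forall x, G x w = teval x t) \/
     (exists b, B (existT _ (vsort w) b) /\ forall x, G x w = b)) ->
  cform (params B) (fun x => feval phi (G x)).
Proof.
move=> H; apply: cform_comp => w; case: (H w) => [[t tP]|[b [Bb bP]]].
  exists (tsub (fun v => @tvar L (csum V (pctx B)) (inl v)) t) => x.
  by rewrite teval_sub tP.
by exists (pvar V Bb) => x; rewrite bP.
Qed.

Lemma same_type_set (B : set (elt M)) (V V' P' : ctx L) (u v : tup M V)
    (u' v' : tup M V') (c' : tup M P') :
  same_type (params B) u v ->
  (forall x, (exists t : lterm V (vsort x), u' x = teval u t /\ v' x = teval v t) \/
     (exists b, [/\ B (existT _ (vsort x) b), u' x = b & v' x = b])) ->
  within B c' ->
  same_type c' u' v'.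
Proof.
move=> uv H Bc; apply: same_type_sub uv _ _ => [x|p].
  case: (H x) => [[t [tu tv]]|[b [Bb bu bv]]].
    exists (tsub (fun v => @tvar L (csum V (pctx B)) (inl v)) t).
    by rewrite !teval_sub tu tv.
  exists (pvar V Bb).
  by rewrite bu bv.
by exists (pvar V (Bc p)).
Qed.

Lemma same_typeS (B B' : set (elt M)) (V : ctx L) (u v : tup M V) :
  B `<=` B' -> same_type (params B') u v -> same_type (params B) u v.
Proof.
move=> BB' uv; apply: same_type_set uv _ _.
  by move=> x; left; exists (tvar x).
by move=> [[s b] Bb] /=; apply: BB'.
Qed.

Lemma within_params (B : set (elt M)) : within B (params B).
Proof. by move=> [[s b] Bb]. Qed.

Lemma same_type0 (P : ctx L) (c : tup M P) (V : ctx L) (u v : tup M V) :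
  same_type c u v -> same_type tup0 u v.
Proof.
move=> uv; apply: same_type_sub uv _ _ => [x|[]].
by exists (@tvar L (csum V P) (inl x)).
Qed.

Lemma indisc0 (P : ctx L) (c : tup M P) (X : ctx L) (O : Type) (lt : rel O)
    (a : O -> tup M X) : indiscernible c lt a -> indiscernible tup0 lt a.
Proof. by move=> H n t u it iu; apply: same_type0 (H n t u it iu). Qed.

End SetParameters.

(** * Saturation, coheirs and automorphisms *)

Section Realize.
Variables (R : realType) (L : lang) (M : struct R L).

(* [u] realizes over [c] the global type of the formulas holding on a set of [W]. *)
Definition ultra_real (P : ctx L) (c : tup M P) (V : ctx L)
    (W : set_system (tup M V)) (u : tup M V) : Prop :=
  forall f, cform c f -> forall e : R, 0 < e -> W [set x | `|f x - f u| < e].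

Lemma cform_sub (P P' : ctx L) (c : tup M P) (c' : tup M P') (V : ctx L)
    (f : tup M V -> R) :
  (forall p, exists t : lterm P' (vsort p), c p = teval c' t) ->
  cform c f -> cform c' f.
Proof.
move=> H [phi phiP].
have -> : f = (fun x => feval phi (tsum x c)) by apply/funext => x.
apply: cform_comp => -[v|p].
  by exists (@tvar L (csum V P') (inl v)).
have [t tP] := H p.
by exists (tsub (fun v => @tvar L (csum V P') (inr v)) t) => x; rewrite teval_sub /= tP.
Qed.

Lemma ultra_real_sub (P P' : ctx L) (c : tup M P) (c' : tup M P') (V : ctx L)
    (W : set_system (tup M V)) (u : tup M V) :
  (forall p, exists t : lterm P' (vsort p), c p = teval c' t) ->
  ultra_real c' W u -> ultra_real c W u.
Proof. by move=> H cW f /(cform_sub H); apply: cW. Qed.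

Lemma ultra_real_const (P : ctx L) (c : tup M P) (V : ctx L) (W : set_system (tup M V))
    (FW : ProperFilter W) (u : tup M V) (f : tup M V -> R) (r : R) :
  ultra_real c W u -> cform c f -> (forall e, 0 < e -> W [set x | `|f x - r| < e]) -> f u = r.
Proof.
move=> cW cf H; apply: eqr_eps => e e0.
have e2 : 0 < e / 2 by lra.
have [x [/= x1 x2]] := filter_ex (filterI (cW f cf _ e2) (H _ e2)).
by move: x1 x2; rewrite !ltr_norml; lra.
Qed.

Lemma ultra_real_eq (P : ctx L) (c : tup M P) (V : ctx L) (W : set_system (tup M V))
    (FW : ProperFilter W) (u : tup M V) (f g : tup M V -> R) :
  ultra_real c W u -> cform c f -> cform c g ->
  (forall e, 0 < e -> W [set x | `|f x - g x| < e]) -> f u = g u.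
Proof.
move=> cW cf cg H; apply: eqr_eps => e e0.
have e3 : 0 < e / 3 by lra.
have [x [[/= x1 x2] x3]] := filter_ex (filterI (filterI (cW f cf _ e3) (cW g cg _ e3)) (H _ e3)).
by move: x1 x2 x3; rewrite /= !ltr_norml; lra.
Qed.

(* A form of "x is definable over c". *)
Definition dclo (P : ctx L) (c : tup M P) (V : ctx L) (x : tup M V) : Prop :=
  forall (Y : ctx L) (y y' : tup M Y), same_type c y y' -> same_type x y y'.

Lemma dclo_within (B : set (elt M)) (V : ctx L) (x : tup M V) :
  within B x -> dclo (params B) x.
Proof. by move=> Bx Y y y' H; apply: same_type_set H _ Bx => v; left; exists (tvar v). Qed.

Definition below (V : ctx L) (s : nat -> tup M V) (k : nat) :
    tup M (crep V {j | (j < k)%N}) := block s (fun j : {j | (j < k)%N} => sval j).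
Arguments below {V} s k.

(** By induction on the length of the tuple: W lets the last entry be replaced by some x definable
    over c, and x is then absorbed in the parameters when the induction hypothesis is applied to the
    remaining entries. *)
Lemma coheir_indisc (P : ctx L) (c : tup M P) (V : ctx L) (W : set_system (tup M V))
    (FW : ProperFilter W) (s : nat -> tup M V) :
  W [set x | dclo c x] -> (forall k, ultra_real (tsum c (below s k)) W (s k)) ->
  indiscernible c ltn s.
Proof.
move=> Wc Ws; elim=> [|n IH] t u it iu.
  apply: same_type_sub (same_type_refl c (block s t)) _ _.
    by move=> [x []].
  by move=> p; exists (@tvar L (csum (crep V 'I_0) P) (inr p)).
pose wd (i : 'I_n) := widen_ord (leqnSn n) i.
pose G (t : 'I_n.+1 -> nat) (x : tup M V) : tup M (crep V 'I_n.+1) :=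
  block (fun i => if unlift ord_max i is Some j then s (t (wd j)) else x) id.
have wdE j : lift ord_max j = wd j.
  by apply: val_inj; rewrite /= /bump leqNgt ltn_ord.
have GE (t0 : 'I_n.+1 -> nat) : G t0 (s (t0 ord_max)) = block s t0.
  apply/functional_extensionality_dep => -[x i]; rewrite /G /block /=.
  by case: (unliftP ord_max i) => [j|] ->; rewrite // wdE.
have G_cform (t0 : 'I_n.+1 -> nat) (phi : lform (csum (crep V 'I_n.+1) P)) :
    increasing (@ord_lt _) ltn t0 ->
    cform (tsum c (below s (t0 ord_max))) (fun x => feval phi (tsum (G t0 x) c)).
  move=> it0; apply: cform_comp => -[[x i]|p] /=.
    rewrite /G /block /=; case: (unlift ord_max i) => [j|].
      have h : (t0 (wd j) < t0 ord_max)%N by apply: it0; rewrite /ord_lt /= ltn_ord.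
      by exists (@tvar L (csum V (csum P (crep V {j0 | (j0 < t0 ord_max)%N})))
        (inr (inr (x, exist _ (t0 (wd j)) h)))).
    by exists (@tvar L (csum V (csum P (crep V {j0 | (j0 < t0 ord_max)%N}))) (inl x)).
  by exists (@tvar L (csum V (csum P (crep V {j0 | (j0 < t0 ord_max)%N}))) (inr (inl p))).
have Gtu x : dclo c x -> same_type c (G t x) (G u x).
  move=> cx.
  have := IH (fun j => t (wd j)) (fun j => u (wd j)).
  move=> /(_ (fun i j ij => it (wd i) (wd j) ij) (fun i j ij => iu (wd i) (wd j) ij)) H.
  have {H} H : same_type c (tsum (block s (fun j => t (wd j))) c)
      (tsum (block s (fun j => u (wd j))) c).
    apply: (same_type_sub H) => [[y|p]|p].
    - by exists (@tvar L (csum (crep V 'I_n) P) (inl y)).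
    - by exists (@tvar L (csum (crep V 'I_n) P) (inr p)).
    - by exists (@tvar L (csum (crep V 'I_n) P) (inr p)).
  apply: (same_type_sub (cx _ _ _ H)).
    move=> [y i]; rewrite /G /block /=; case: (unlift ord_max i) => [j|].
      by exists (@tvar L (csum (csum (crep V 'I_n) P) V) (inl (inl (y, j)))).
    by exists (@tvar L (csum (csum (crep V 'I_n) P) V) (inr y)).
  by move=> p; exists (@tvar L (csum (csum (crep V 'I_n) P) V) (inl (inr p))).
move=> phi; rewrite -!GE; apply: eqr_eps => e e0; have e2 : 0 < e / 2 by lra.
have [x [[/= x1 x2] x3]] := filter_ex (filterI (filterI
  (Ws _ _ (G_cform t phi it) _ e2) (Ws _ _ (G_cform u phi iu) _ e2)) Wc).
by move: x1 x2 (Gtu x x3 phi); rewrite !ltr_norml; lra.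
Qed.

End Realize.
Arguments below {R L M V} s k.

Section Automorphisms.
Variables (R : realType) (L : lang) (M : struct R L).

Definition actt (g : forall s, sdom M s -> sdom M s) (V : ctx L) (a : tup M V) :
  tup M V := fun v => g _ (a v).

Lemma aut_teval g (V : ctx L) (a : tup M V) s (t : lterm V s) :
  is_aut g -> teval (actt g a) t = g _ (teval a t).
Proof.
case=> _ _ gf _; elim: t => //= f u IH; rewrite gf; congr fint.
by apply/functional_extensionality_dep => i; apply: IH.
Qed.

Lemma aut_feval g (V : ctx L) (phi : lform V) (a : tup M V) :
  is_aut g -> feval phi (actt g a) = feval phi a.
Proof.
move=> Hg; have [gb gd gf gp] := Hg.
elim: phi a => {V} /= [V s t u|V P u|V p IH|V p IHp q IHq|V h p IH|V s p IH] a.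
- by rewrite !aut_teval// gd.
- rewrite -[RHS]gp; congr pint; apply/functional_extensionality_dep => i.
  by rewrite aut_teval.
- by rewrite IH.
- by rewrite IHp IHq.
- by rewrite IH.
- have gE c : actt g (text a c) = text (actt g a) (g _ c).
    by apply/functional_extensionality_dep => -[v|].
  congr sup; apply/seteqP; split=> [_ [c _ <-]|_ [c _ <-]].
    case: (gb s) => g' gK g'K; exists (g' c) => //.
    by rewrite -IH gE g'K.
  by exists (g _ c) => //; rewrite -gE IH.
Qed.

Lemma aut_inv g : is_aut g -> exists g' : forall s, sdom M s -> sdom M s,
  [/\ is_aut g', forall s x, g' s (g s x) = x & forall s x, g s (g' s x) = x].
Proof.
move=> [gb gd gf gp].
have H s : exists g' : sdom M s -> sdom M s, cancel (g s) g' /\ cancel g' (g s).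
  by case: (gb s) => g' gK g'K; exists g'.
pose g' s := sval (cid (H s)).
have gK s x : g' s (g s x) = x by rewrite /g'; case: (cid (H s)) => ? [].
have g'K s x : g s (g' s x) = x by rewrite /g'; case: (cid (H s)) => ? [].
exists g'; split=> //; split.
- by move=> s; exists (g s) => x.
- by move=> s x y; rewrite -(gd s) !g'K.
- move=> f x; rewrite -[RHS]gK gf; congr (g' _ (fint _)).
  by apply/functional_extensionality_dep => i; rewrite g'K.
- move=> P x; rewrite -gp; congr pint.
  by apply/functional_extensionality_dep => i; rewrite g'K.
Qed.

Lemma aut_same_type g (P : ctx L) (c : tup M P) (V : ctx L) (u v : tup M V) :
  is_aut g -> same_type c u v -> same_type (actt g c) (actt g u) (actt g v).
Proof.
move=> Hg uv phi.
have E (w : tup M V) : tsum (actt g w) (actt g c) = actt g (tsum w c).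
  by apply/functional_extensionality_dep => -[].
by rewrite !E !aut_feval.
Qed.

Lemma aut_indisc g (P : ctx L) (c : tup M P) (V : ctx L) (O : Type) (lt : rel O)
    (a : O -> tup M V) :
  is_aut g -> indiscernible c lt a ->
  indiscernible (actt g c) lt (fun i => actt g (a i)).
Proof. by move=> Hg H n t u it iu; apply: (aut_same_type Hg (H n t u it iu)). Qed.

Lemma actt_fix g (P : ctx L) (c : tup M P) : fixes c g -> actt g c = c.
Proof. by move=> gc; apply/functional_extensionality_dep => p; apply: gc. Qed.

Lemma aut_divides g (P : ctx L) (c : tup M P) (X Y : ctx L) (phi : lform (csum X Y))
    (b : tup M Y) (r : R) :
  is_aut g -> fixes c g -> divides c phi b r -> divides c phi (actt g b) r.
Proof.
move=> Hg gc [b_ [b0 bi bN]]; exists (fun i => actt g (b_ i)); split.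
- by rewrite b0.
- by rewrite -(actt_fix gc); apply: aut_indisc.
- have [g' [Hg' gK g'K]] := aut_inv Hg.
  move=> [x xP]; apply: bN; exists (actt g' x) => i.
  rewrite -(aut_feval _ _ Hg); apply: le_trans (xP i).
  rewrite le_eqVlt; apply/orP; left; apply/eqP; congr feval.
  by apply/functional_extensionality_dep => -[v|v]; rewrite /actt /= ?g'K.
Qed.

End Automorphisms.

Section Saturation.
Variables (K : Type) (R : realType) (L : lang) (M : struct R L).
Hypothesis HM : monster K M.

Local Notation sm T := (small K [set: T]).

(** The conditions that hold on a set of F are finitely satisfiable because F is proper, so
    saturation satisfies them all at once. *)
Lemma sat (V P : ctx L) (c : tup M P) (F : set_system (tup M V))
    (FF : ProperFilter F) :
  sm (var V) -> sm (var P) ->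
  exists u, forall f, cform c f -> forall r, F [set x | f x <= r] -> f u <= r.
Proof.
move=> sV sP.
have [D fD DG|u uP] := mon_sat HM (c := c) (G := [set q : lform (csum V P) * R |
    F [set x | feval q.1 (tsum x c) <= q.2]]) sV sP.
  have : F (\bigcap_(q in D) [set x | feval q.1 (tsum x c) <= q.2]).
    by apply: filter_finite => // q /DG.
  by move/filter_ex => [u uP]; exists u => q /uP.
exists u => f [phi phiP] r Fr; rewrite phiP; apply: (uP (phi, r)) => /=.
by apply: filterS Fr => x /=; rewrite phiP.
Qed.

Lemma sat_lim (V P : ctx L) (c : tup M P) (F : set_system (tup M V))
    (FF : ProperFilter F) :
  sm (var V) -> sm (var P) ->
  exists u, forall f, cform c f -> forall r,
    (forall e, 0 < e -> F [set x | `|f x - r| < e]) -> f u = r.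
Proof.
move=> sV sP; have [u uP] := sat c FF sV sP; exists u => f cf r H.
apply: eqr_eps => e e0; have e2 : 0 < e / 2 by lra.
have : f u <= r + e / 2.
  by apply: uP => //; apply: filterS (H _ e2) => x /=; rewrite ltr_norml; lra.
have : 1 - f u <= 1 - r + e / 2.
  apply: (uP (fun x => 1 - f x)); first exact: cform_neg.
  by apply: filterS (H _ e2) => x /=; rewrite ltr_norml; lra.
by rewrite ltr_norml; lra.
Qed.

(** Saturation gives upper bounds only. If f were not W-often close to f u, the ultrafilter would
    decide on which side its values lie, and the bound for f or for 1 - f would be violated at u. *)
Lemma realize (V P : ctx L) (c : tup M P) (W : set_system (tup M V))
    (FW : UltraFilter W) :
  sm (var V) -> sm (var P) -> exists u, ultra_real c W u.
Proof.
move=> sV sP; have [u uP] := sat c (@ultra_proper _ W FW) sV sP; exists u => f cf e e0.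
have [//|H] := in_ultra_setVsetC [set x | `|f x - f u| < e] FW.
exfalso; have [H1|H1] := in_ultra_setVsetC [set x | f x <= f u - e] FW.
  by have := uP f cf _ H1; lra.
have : W [set x | 1 - f x <= 1 - f u - e].
  apply: filterS (filterI H H1) => x /= [/negP h1 /negP h2].
  by move: h1 h2; rewrite ltr_norml -!ltNge; lra.
by move/(uP _ (cform_neg cf)); lra.
Qed.

Lemma coheir_exists (V P : ctx L) (c : tup M P) (W : set_system (tup M V))
    (FW : UltraFilter W) :
  sm (var V) -> sm (var P) ->
  exists s, forall k, ultra_real (tsum c (below s k)) W (s k).
Proof.
move=> sV sP.
have [|||s sP'] := @dep_choice_nat (tup M V) (fun n e => forall k, (k < n)%N ->
    ultra_real (tsum c (below e k)) W (e k)).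
- move=> n e e' ee' H k kn; rewrite -ee'//.
  suff <- : below e k = below e' k by apply: H.
  apply/functional_extensionality_dep => -[v [j jk]]; rewrite /below /block /=.
  by rewrite ee'//; apply: ltn_trans kn.
- by have [u _] := realize c FW sV sP; exists (fun=> u).
- move=> n e H.
  have [||x xP] := @realize V _ (tsum c (below e n)) W FW.
  + by [].
  + by apply: small_sum => //; [exact: (mon_nat HM)|exact: (mon_pow HM)|
      apply: small_prod => //; [exact: (mon_pow HM)|apply: small_sig; exact: (mon_nat HM)]].
  exists x => k; rewrite ltnS leq_eqVlt => /orP[/eqP ->|kn].
    rewrite eqxx; suff -> : below (fun k0 => if k0 == n then x else e k0) n = below e n by [].
    apply/functional_extensionality_dep => -[v [j jk]]; rewrite /below /block /=.
    by rewrite ifN//; apply/eqP; lia.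
  rewrite ifN; last by apply/eqP; lia.
  suff -> : below (fun k0 => if k0 == n then x else e k0) k = below e k by apply: H.
  apply/functional_extensionality_dep => -[v [j jk]]; rewrite /below /block /=.
  by rewrite ifN//; apply/eqP; lia.
by exists s => k; apply: (sP' k.+1).
Qed.

(** Prolongs a by a sequence whose entries all realize over B the average of a, at least for the
    formulas that have a limit along a. *)
Lemma avg_ext (A B : set (elt M)) (X : ctx L) (O : Type) (lt : rel O) (a : O -> tup M X) :
  sm (var X) -> small K B -> A `<=` B -> (forall i, within B (a i)) ->
  stot lt -> no_last lt -> inhabited O -> indiscernible (params A) lt a ->
  exists g : nat -> tup M X, like (params A) (suml lt ltn) (sumf a g) lt a /\
    forall f, cform (params B) f -> forall r,
      (forall e, 0 < e -> exists i, forall j, lt i j -> `|f (a j) - r| < e) ->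
      forall k, f (g k) = r.
Proof.
move=> sX sB AB Ba lto nl iO Hi.
(* The properties shared by all increasing omega-sequences of a lying far enough out; a formula over
   B with a limit along a is close to this limit on each of their entries. *)
pose F : set_system (tup M (crep X nat)) := [set S | exists j : O,
  forall s : nat -> O, increasing ltn lt s -> (forall k, lt j (s k)) -> S (block a s)].
have FF : ProperFilter F.
  split.
    by move=> [j /= H]; have [s [s1 s2]] := inc_above lto nl j; apply: (H s).
  split.
  - by case: iO => j; exists j.
  - move=> S S' [j jS] [j' jS'].
    have [ub ubP] := ub_fin lto nl iO (fun b : 'I_2 => if b == ord0 then j else j').
    case: lto => _ tr _; exists ub => s si sb; split.
      by apply: jS => // k; apply: tr (sb k); exact: (ubP ord0).
    by apply: jS' => // k; apply: tr (sb k); exact: (ubP ord_max).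
  - by move=> S S' SS' [j jS]; exists j => s si sb; apply/SS'/jS.
have sXn : sm (var (crep X nat)).
  by apply: small_prod => //; [exact: (mon_pow HM)|exact: (mon_nat HM)].
have sB' : sm (var (pctx B)) by exact: (small_setT K B).1.
have [u uP] := sat_lim (params B) FF sXn sB'.
pose sq (x : tup M (crep X nat)) : nat -> tup M X := fun k y => x (y, k).
exists (sq u); split.
  move=> n t t' it it' phi.
  have [io] := iO.
  have [ub ubP] := ub_fin lto nl iO
    (fun i : 'I_n => if t i is inl j then j else io).
  pose G (x : tup M (crep X nat)) : tup M (csum (crep X 'I_n) (pctx A)) :=
    tsum (block (sumf a (sq x)) t) (params A).
  apply: (uP (fun x => feval phi (G x))).
    apply: cform_set => -[[y i]|[[s b] Ab]] /=.
      rewrite /block /=; case: (t i) => [j|k] /=.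
        by right; exists (a j y); split => //; apply: (Ba j).
      by left; exists (@tvar L (crep X nat) (y, k)).
    by right; exists b; split => //; apply: AB.
  move=> e e0; exists ub => s si sb /=.
  suff -> : feval phi (G (block a s)) = feval phi (tsum (block a t') (params A)).
    by rewrite subrr normr0.
  rewrite /G.
  have -> : block (sumf a (sq (block a s))) t = block a (fun i => sumf id s (t i)).
    by apply/functional_extensionality_dep => -[y i]; rewrite /block /=; case: (t i).
  apply: (Hi n _ t' _ it') => i j /it; have := ubP i.
  case: (t i) => [ti|ti]; case: (t j) => [tj|tj] //=.
  - by move=> h _; case: lto => _ tr _; apply: tr h (sb tj).
  - by move=> _; exact: si.
move=> f cf r H k.
have [phi phiP] := cf.
have := uP (fun x => f (sq x k)); apply.
  have -> : (fun x => f (sq x k)) = (fun x => feval phi (tsum (sq x k) (params B))).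
    by apply/funext => x.
  apply: cform_set => -[y|p] /=.
    by left; exists (@tvar L (crep X nat) (y, k)).
  by right; exists (params B p); split => //; apply: within_params.
move=> e /H [i iP]; exists i => s si sb /=; exact: (iP (s k) (sb k)).
Qed.

End Saturation.

(** * Eventually determined formulas *)

Section Dependence.
Variables (K : Type) (R : realType) (L : lang) (M : struct R L).
Hypotheses (HM : monster K M) (Hdep : dependent K M).

Local Notation sm T := (small K [set: T]).

Lemma form_support_r (X P : ctx L) (phi : lform (csum X P)) :
  exists2 F : set (var P), finite_set F & exists phi' : lform (csum X (rstr F)),
    forall (x : tup M X) (c : tup M P),
      feval phi' (tsum x (tres F c)) = feval phi (tsum x c).
Proof.
have [F fF /(_ F (@subset_refl _ _))[phi' phi'P]] := form_support M phi.
exists [set p | F (inr p)].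
  by apply: finite_preimage => // x y _ _ [].
pose r : subst (rstr F) (csum X (rstr [set p | F (inr p)])) := fun o =>
  match o return lterm (csum X (rstr [set p | F (inr p)])) (vsort (c := rstr F) o) with
  | exist (inl x) Fv => @tvar L (csum X (rstr [set p | F (inr p)])) (inl x)
  | exist (inr p) Fv => @tvar L (csum X (rstr [set p | F (inr p)])) (inr (exist _ p Fv))
  end.
exists (fsub phi' r) => x c; rewrite feval_sub -phi'P; congr feval.
by apply/functional_extensionality_dep => -[[v|v] Fv].
Qed.

(** Dependence is stated for finite contexts, while c may be the whole model; a single formula uses
    finitely many entries of c. *)
Lemma dep_lim (X : ctx L) (J : eseq (tup M X)) (P : ctx L) (c : tup M P)
    (f : tup M X -> R) :
  fin_ctx X -> small_seq K J -> indisc_seq tup0 J -> cform c f ->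
  exists r, has_lim (fun i : idx J => f (J i)) r.
Proof.
move=> fX sJ iJ [phi phiP]; have [F fF [phi' phi'P]] := form_support_r phi.
have [r rP] := Hdep phi' (tres F c) fX (fin_rstr fF) sJ iJ.
exists r => e /rP[i iP]; exists i => j ij.
by rewrite phiP -phi'P; exact: iP.
Qed.

Lemma has_lim_uniq d (O : orderType d) (f : O -> R) (r r' : R) :
  inhabited O -> has_lim f r -> has_lim f r' -> r = r'.
Proof.
move=> [i0] H H'; apply: eqr_eps => e e0; have e2 : 0 < e / 2 by lra.
have [i iP] := H _ e2; have [j jP] := H' _ e2.
have := iP (Order.max i j); have := jP (Order.max i j).
rewrite !le_max !lexx orbT => /(_ isT) + /(_ isT).
by rewrite !ltr_norml; lra.
Qed.

End Dependence.

Lemma nat_nolast : forall i : nat, exists j : nat, (i < j)%O.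
Proof. by move=> i; exists i.+1; rewrite ltEnat /=. Qed.

Definition nat_eseq (T : Type) (g : nat -> T) : eseq T :=
  @ESeq T _ nat g (inhabits 0%N) nat_nolast.

Lemma idx_ltn (i j : nat) : idx_lt i j = (i < j)%N.
Proof. by rewrite /idx_lt ltEnat. Qed.

(* The order type omega + omega. *)
Definition omega2 : Type := (bool *l nat)%type.

Lemma omega2_nolast : forall i : omega2, exists j : omega2, (i < j)%O.
Proof.
by move=> [b n]; exists (b, n.+1); rewrite ltEprodlexi /= lexx /= ltEnat /=.
Qed.

Definition omega2_sum (p : omega2) : nat + nat := if p.1 then inr p.2 else inl p.2.

Lemma omega2_lt (p q : omega2) :
  idx_lt p q = suml ltn ltn (omega2_sum p) (omega2_sum q).
Proof.
by case: p q => [[] m] [[] n]; rewrite /idx_lt ltEprodlexi /= ?ltEnat.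
Qed.

Definition omega2_eseq (T : Type) (a b : nat -> T) : eseq T :=
  @ESeq T _ omega2 (fun p => sumf a b (omega2_sum p)) (inhabits (false, 0%N))
    omega2_nolast.

Section EventualExists.
Variables (K : Type) (R : realType) (L : lang) (M : struct R L).
Hypotheses (HM : monster K M) (Hdep : dependent K M).
Variables (A : set (elt M)) (HA : small K A) (X : ctx L) (HX : fin_ctx X).

Local Notation sm T := (small K [set: T]).
Let Kn := mon_nat HM.
Let Kp := mon_pow HM.

Variables (a : nat -> tup M X) (Ha : indiscernible (params A) ltn a).
Variables (P : ctx L) (b : tup M P) (phi : lform (csum X P)).

Let f (x : tup M X) : R := feval phi (tsum x b).
Let Cont (g : nat -> tup M X) : Prop :=
  indiscernible (params A) (suml ltn ltn) (sumf a g).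

Let cont_ex : exists g, Cont g.
Proof.
pose B := A `|` comps (fun v : var (crep X nat) => a v.2 v.1).
have [||||||||g [g1 _]] := @avg_ext K R L M HM A B X nat ltn a.
- exact: small_fin.
- apply: small_setU => //; apply: small_image => //; apply: small_prod => //.
  exact: small_fin.
- by move=> x; left.
- by move=> i v; right; exists (v, i).
- exact: stot_ltn.
- by move=> n; exists n.+1 => /=.
- exact: (inhabits 0%N).
- exact: Ha.
exists g; apply: (like_indiscernible stot_ltn _ _ g1).
  by move=> n; exists n.+1 => /=.
exact: (inhabits 0%N).
Qed.

Let agree n (g e : nat -> tup M X) : Prop := forall k, (k < n)%N -> g k = e k.

(** The invariant of the greedy choice: at each position k the freedom left to f, once the entries
    below k are fixed, is at most 5 times the jump that e makes there. Position 0 is excluded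
    because it has no previous entry to jump from. *)
Let good n (e : nat -> tup M X) : Prop :=
  (exists2 g, Cont g & agree n g e) /\
  forall k, (0 < k)%N -> (k < n)%N -> forall g g', Cont g -> Cont g' ->
    agree k g e -> agree k g' e ->
    `|f (g k) - f (g' k)| <= 5 * `|f (e k) - f (e k.-1)|.

(* Greedy choice: the next entry moves the value of [f] by a fixed fraction of the
   largest possible variation. By dependence these variations tend to 0, so that
   nothing continuing the resulting sequence can change the limit. *)
Let good_step n e : good n e ->
  exists x, good n.+1 (fun k => if k == n then x else e k).
Proof.
move=> [[g Cg ge] H].
suff [g1 [Cg1 g1e Hg1]] : exists g1, [/\ Cont g1, agree n g1 e &
    (0 < n)%N -> forall g g', Cont g -> Cont g' -> agree n g e -> agree n g' e ->
    `|f (g n) - f (g' n)| <= 5 * `|f (g1 n) - f (e n.-1)|].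
  exists (g1 n); split.
    exists g1 => // k; rewrite ltnS leq_eqVlt => /orP[/eqP ->|kn]; first by rewrite eqxx.
    by rewrite ifN ?g1e//; apply/eqP; lia.
  have ag k g' : (k <= n)%N -> agree k g' (fun k => if k == n then g1 n else e k) ->
      agree k g' e.
    by move=> kn h j jk; rewrite h// ifN//; apply/eqP; lia.
  move=> k k0; rewrite ltnS leq_eqVlt => /orP[/eqP kn|kn] g2 g3 C2 C3 /ag a2 /ag a3.
    subst k; rewrite eqxx ifN; last by apply/eqP; lia.
    by apply: Hg1 => //; [apply: a2|apply: a3].
  by rewrite ifN ?ifN; [|by apply/eqP; lia|by apply/eqP; lia]; apply: H => //;
    [apply: a2|apply: a3]; apply: ltnW.
case: n => [|n] in ge H *; first by exists g.
set v := f (e n).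
pose S : set R := [set r | exists g g', [/\ Cont g, Cont g', agree n.+1 g e,
  agree n.+1 g' e & r = `|f (g n.+1) - f (g' n.+1)|]].
have Sub : ubound S 1.
  move=> _ [h [h' [_ _ _ _ ->]]].
  have := feval01 phi (tsum (h n.+1) b); have := feval01 phi (tsum (h' n.+1) b).
  by rewrite -/(f _) -/(f _) ler_norml; lra.
have S0 : S 0 by exists g, g; rewrite subrr normr0.
have Ss h h' : Cont h -> Cont h' -> agree n.+1 h e -> agree n.+1 h' e ->
    `|f (h n.+1) - f (h' n.+1)| <= sup S.
  by move=> Ch Ch' ha ha'; apply: ub_le_sup; [exists 1|exists h, h'].
have [s0|s0] := leP (sup S) 0.
  exists g; split => // _ h h' Ch Ch' ha ha'.
  apply: le_trans (Ss _ _ Ch Ch' ha ha') _; apply: le_trans s0 _.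
  by rewrite mulr_ge0.
have s2 : 0 < sup S / 2 by lra.
have [|_ [h [h' [Ch Ch' ha ha' ->]]] hs] := @sup_adherent _ S _ s2.
  by split; [exists 0|exists 1].
(* The values at h and h' are more than sup S / 2 apart, so one of them is at least sup S / 5 away
   from the previous value v. Any factor from 4 on works in place of 5. *)
have [hv|hv] := leP (sup S) (5 * `|f (h n.+1) - v|).
  by exists h; split => // _ g2 g3 C2 C3 a2 a3; apply: le_trans (Ss _ _ C2 C3 a2 a3) _.
exists h'; split => // _ g2 g3 C2 C3 a2 a3; apply: le_trans (Ss _ _ C2 C3 a2 a3) _.
rewrite /=; move: (ler_distD v (f (h n.+1)) (f (h' n.+1))).
by rewrite [`|v - _|]distrC -/v; lra.
Qed.

Let greedy : exists e, forall n, good n e.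
Proof.
apply: dep_choice_nat.
- move=> n e e' ee' [[g Cg ge] H]; split.
    by exists g => // k kn; rewrite ge// ee'.
  move=> k k0 kn g1 g2 C1 C2 a1 a2; rewrite -!ee'; [|lia|lia].
  by apply: H => // j jk; rewrite ?a1 ?a2// ee'//; lia.
- by have [g Cg] := cont_ex; exists g; split; [exists g|].
- exact: good_step.
Qed.

Lemma ev_determined_exists : exists e : nat -> tup M X,
  [/\ indisc_seq (params A) (omega2_eseq a e),
      ev_determines K (params A) (omega2_eseq a e) b phi
    & exists r, has_lim (fun i : idx (omega2_eseq a e) =>
        feval phi (tsum (omega2_eseq a e i) b)) r].
Proof.
have [e He] := greedy; exists e.
(* Indiscernibility concerns finitely many entries at a time, and a long enough initial part of e
   has a completion g that continues a. *)
have Ce : Cont e.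
  move=> n t u it iu.
  have [N NP] := @ub_fin _ ltn stot_ltn (fun n => ex_intro _ n.+1 (ltnSn n))
    (inhabits 0%N) _ (fun i : 'I_(n + n) => match
       match fintype.split i with inl j => t j | inr j => u j end with
       | inr k => k | inl _ => 0%N end).
  have [[g Cg ge] _] := He N.
  have -> : block (sumf a e) t = block (sumf a g) t.
    apply/functional_extensionality_dep => -[x i]; rewrite /block /=.
    have := NP (unsplit (inl i)); rewrite unsplitK.
    by case: (t i) => //= k kN; rewrite ge.
  have -> : block (sumf a e) u = block (sumf a g) u.
    apply/functional_extensionality_dep => -[x i]; rewrite /block /=.
    have := NP (unsplit (inr i)); rewrite unsplitK.
    by case: (u i) => //= k kN; rewrite ge.
  exact: Cg.
have ie : indiscernible (params A) ltn e.
  by apply: (@indisc_comp _ _ _ _ _ _ _ _ (sumf a e) _ ltn inr _ Ce) => i j ij.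
have iJ : indisc_seq (params A) (omega2_eseq a e).
  apply: (@indisc_comp _ _ _ _ _ _ _ _ (sumf a e) _ _ omega2_sum _ Ce) => p q.
  by rewrite omega2_lt.
have [r rP] : exists r, has_lim (fun i : idx (nat_eseq e) => f (nat_eseq e i)) r.
  apply: (dep_lim Hdep HX (c := b)).
  - exact: Kn.
  - by apply: (indisc0 (c := params A)) => n t u it iu; apply: ie => i j ij;
      [move: (it _ _ ij)|move: (iu _ _ ij)]; rewrite idx_ltn.
  - by exists phi.
have fe (eps : R) : 0 < eps -> exists N, forall k, (N <= k)%N -> `|f (e k) - r| < eps.
  by move=> /rP[N NP]; exists N => k Nk; apply: NP; rewrite leEnat.
exists.
- exact: iJ.
- exists r => J' sJ' JJ'.
  (* More than convergence holds: f is constant along J'. *)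
  suff fJ' j : f (J' j) = r.
    by move=> eps eps0; have [i0] := idx_inh J'; exists i0 => j _;
      rewrite -/(f _) fJ' subrr normr0.
  apply: eqr_eps => eps eps0.
  (* Consecutive late values of f on e differ by less than eps / 6, the greedy bound multiplies this
     by 5, and the distance eps / 12 to r still fits below eps. *)
  have eps2 : 0 < eps / 12 by lra.
  have [N NP] := fe _ eps2.
  have [s [si s0]] := inc_from (stot_idx (idx J')) (@idx_nolast _ J') j.
  pose k := N.+1.
  (* A continuation of a that follows e below k and has J' j at position k, so that the greedy bound
     compares f (J' j) with f (e k). *)
  pose g i := if (i < k)%N then e i else J' (s (i - k)%N).
  have Cg : Cont g.
    pose p (x : nat + nat) : idx (omega2_eseq a e) + idx J' := match x with
      | inl n => inl (false, n)
      | inr i => if (i < k)%N then inl (true, i) else inr (s (i - k)%N) end.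
    rewrite /Cont; have -> : sumf a g = @cat_elem _ (omega2_eseq a e) J' \o p.
      by apply/funext => -[n|n] //=; rewrite /g /=; case: ifP.
    apply: indisc_comp JJ' => -[m|m] [n|n] //=.
    + by move=> _; case: ifP => _ //; exact: (omega2_lt (false, m) (true, n)).
    + move=> mn; case: ifP => mk; case: ifP => nk //=.
      * by lia.
      * by apply: si => /=; lia.
  have := (He k.+1).2 k isT (ltnSn k) g e Cg Ce.
  have -> : g k = J' j by rewrite /g ltnn subnn s0.
  have ge : agree k g e by move=> i ik; rewrite /g ik.
  move=> /(_ ge (fun _ _ => erefl)).
  have := NP N (leqnn N); have := NP k (leqnSn N); rewrite /k /=.
  move: (f (e N.+1)) (f (e N)) (f (J' j)) => x y z h1 h2 h3.
  have h4 : `|x - y| < eps / 6.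
    move: h1 h2; rewrite !ltr_norml => /andP[h1 h1'] /andP[h2 h2'].
    by apply/andP; split; lra.
  have {h3 h4} : `|z - x| < 5 * eps / 6 by lra.
  move: h1; rewrite !ltr_norml => /andP[h1 h1'] /andP[h3 h3'].
  by apply/andP; split; lra.
- exists r => eps /fe[N NP]; exists (true, N) => -[[] n]; rewrite leEprodlexi /= ?leEnat//.
  exact: NP.
Qed.

End EventualExists.

Section MoreTypes.
Variables (R : realType) (L : lang) (M : struct R L).

Lemma finite_sumT (T U : Type) :
  finite_set [set: T] -> finite_set [set: U] -> finite_set [set: T + U].
Proof.
move=> fT fU; have -> : [set: T + U] = inl @` setT `|` inr @` setT.
  by apply/seteqP; split=> // -[x|x] _; [left|right]; exists x.
by rewrite finite_setU; split; apply: finite_image.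
Qed.

Lemma fin_bound (T : Type) (S : set T) (h : T -> nat) :
  finite_set S -> exists N, forall x, S x -> (h x < N)%N.
Proof.
move=> fS; have [n [r [_ rP _]]] := fin_sorted stot_ltn (finite_image h fS).
have [N NP] := @ub_fin _ ltn stot_ltn (fun n => ex_intro _ n.+1 (ltnSn n)) (inhabits 0%N) _ r.
by exists N => x Sx; have [|i <-] := rP (h x); [exists x|exact: NP].
Qed.

Lemma same_type_fin_params (P : ctx L) (c : tup M P) (V : ctx L) (u v : tup M V) :
  (forall F, finite_set F -> same_type (tres F c) u v) -> same_type c u v.
Proof.
move=> H phi; have [F fF [phi' phi'P]] := form_support_r M phi.
by rewrite -!phi'P; apply: H.
Qed.

Lemma same_type_add (B : set (elt M)) (X V : ctx L) (x : tup M X) (u v : tup M V) :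
  same_type (tsum (params B) x) u v -> same_type (params (B `|` comps x)) u v.
Proof.
move=> uv; apply: (same_type_sub uv).
  by move=> y; exists (@tvar L (csum V (csum (pctx B) X)) (inl y)).
move=> [el Hel]; have [Bel|[y _ yel]] := Hel.
  by exists (@tvar L (csum V (csum (pctx B) X)) (inr (inl (exist _ el Bel)))).
by subst el; exists (@tvar L (csum V (csum (pctx B) X)) (inr (inr y))).
Qed.

(** Two increasing tuples t and u are each followed by the same blocks lying above both, and each is
    compared with the first of these. The test thus involves only the first two terms of a sequence
    of successive blocks, which is the form that arguments about dividing can handle. *)
Lemma indisc_by_far (P : ctx L) (c : tup M P) (X : ctx L) (O : Type) (lt : rel O)
    (a : O -> tup M X) :
  stot lt -> no_last lt -> inhabited O ->
  (forall n (p : nat -> 'I_n -> O), (forall i, increasing (@ord_lt n) lt (p i)) ->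
     (forall i j z z', (i < j)%N -> lt (p i z) (p j z')) ->
     same_type c (block a (p 0%N)) (block a (p 1%N))) ->
  indiscernible c lt a.
Proof.
move=> lto nl iO H n t u it iu.
have [s [si sP]] := inc_above_fin lto nl iO (fun i : 'I_(n + n) =>
  match fintype.split i with inl j => t j | inr j => u j end).
pose p (w : 'I_n -> O) (k : nat) (z : 'I_n) : O :=
  if k is k'.+1 then s (k' * n + z)%N else w z.
have Hp w : increasing (@ord_lt n) lt w -> (forall z k, lt (w z) (s k)) ->
    same_type c (block a w) (block a (p w 1%N)).
  move=> iw ws; apply: (H n (p w)).
    by move=> [|k] //= i j ij; apply: si => /=; rewrite ltn_add2l.
  move=> [|i] [|j] z z' //= ij; apply: si => /=.
  have := ltn_ord z; have := ltn_ord z'; nia.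
apply: same_type_trans (Hp t it _) _.
  by move=> z k; have := sP (unsplit (inl z)) k; rewrite unsplitK.
apply: same_type_sym; apply: (Hp u iu).
by move=> z k; have := sP (unsplit (inr z)) k; rewrite unsplitK.
Qed.

Lemma indisc_blocks_inc (P : ctx L) (c : tup M P) (X : ctx L)
    (O : Type) (lt : rel O) (a : O -> tup M X) n (p : nat -> 'I_n -> O) :
  stot lt -> indiscernible c lt a -> (forall i, increasing (@ord_lt n) lt (p i)) ->
  (forall i j z z', (i < j)%N -> lt (p i z) (p j z')) ->
  indiscernible c ltn (fun i => block a (p i)).
Proof.
move=> lto ia ip pp; apply: (indisc_blocks lto ia) => // i j z z'.
by rewrite !(stot_inj_inc (@stot_ord n) lto (ip _)).
Qed.

End MoreTypes.

(** * Nonforking extensions *)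

Section Morley.
Variables (K : Type) (R : realType) (L : lang) (M : struct R L).
Hypotheses (HM : monster K M) (Hdep : dependent K M).
Variables (A : set (elt M)) (HA : small K A) (X : ctx L) (HX : fin_ctx X).

Local Notation sm T := (small K [set: T]).
Let Kn := mon_nat HM.
Let Kp := mon_pow HM.

(* The ultrafilter defines a global type which does not fork over A. *)
Definition avoids (U : set_system (tup M X)) : Prop :=
  forall (Y : ctx L) (phi : lform (csum X Y)) (b : tup M Y) (r : R),
    fin_ctx Y -> divides (params A) phi b r -> U [set x | ~ (feval phi (tsum x b) <= r)].

(* Otherwise the pairs (d_2i, d_2i+1) witness that the condition
   phi(x, d_0) - phi(x, d_1) >= e divides: a common solution x would make
   phi(x, d_i) oscillate, against dependence. *)
Lemma avoids_half (U : set_system (tup M X)) (FU : Filter U) (Y : ctx L)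
    (d : nat -> tup M Y) (phi : lform (csum X Y)) (e : R) :
  avoids U -> indiscernible (params A) ltn d -> 0 < e ->
  U [set x | feval phi (tsum x (d 0%N)) - feval phi (tsum x (d 1%N)) < e].
Proof.
move=> avU id e0; have [F fF [phi' phi'P]] := form_support_r M phi.
pose Y2 := csum (rstr F) (rstr F).
pose r0 : subst (csum X (rstr F)) (csum X Y2) := fun w =>
  match w return lterm (csum X Y2) (vsort (c := csum X (rstr F)) w) with
  | inl x => @tvar L (csum X Y2) (inl x)
  | inr y => @tvar L (csum X Y2) (inr (inl y)) end.
pose r1 : subst (csum X (rstr F)) (csum X Y2) := fun w =>
  match w return lterm (csum X Y2) (vsort (c := csum X (rstr F)) w) with
  | inl x => @tvar L (csum X Y2) (inl x)
  | inr y => @tvar L (csum X Y2) (inr (inr y)) end.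
(* The condition chi <= 1 - e expresses that the first value exceeds the second by at least e. The
   parameters were cut down to F because [avoids] concerns finite contexts. *)
pose chi := fneg (fmonus (fsub phi' r0) (fsub phi' r1)).
pose bb i : tup M Y2 := tsum (tres F (d i.*2)) (tres F (d i.*2.+1)).
have chiE x i : feval chi (tsum x (bb i)) =
    1 - Num.max (feval phi (tsum x (d i.*2)) - feval phi (tsum x (d i.*2.+1))) 0.
  have E0 : (fun w => teval (tsum x (bb i)) (r0 w)) = tsum x (tres F (d i.*2)).
    by apply/functional_extensionality_dep => -[].
  have E1 : (fun w => teval (tsum x (bb i)) (r1 w)) = tsum x (tres F (d i.*2.+1)).
    by apply/functional_extensionality_dep => -[].
  by rewrite /= !feval_sub E0 E1 !phi'P.
have : divides (params A) chi (bb 0%N) (1 - e).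
  exists bb; split => //.
    pose p (i : nat) (z : bool) : nat := (i.*2 + z)%N.
    have H : indiscernible (params A) ltn (fun i => block d (p i)).
      apply: (indisc_blocks stot_ltn id) => [i j z z'|i j z z'] /=; rewrite /p.
        by rewrite !ltn_add2l.
      by case: z z' => -[]; lia.
    move=> n t u it iu; apply: (same_type_sub (H n t u it iu)).
      move=> [[y|y] i].
        exists (@tvar L (csum (crep (crep Y bool) 'I_n) (pctx A)) (inl ((sval y, false), i))).
        by rewrite /= /block /= /bb /= /tres /p /= !addn0.
      exists (@tvar L (csum (crep (crep Y bool) 'I_n) (pctx A)) (inl ((sval y, true), i))).
      by rewrite /= /block /= /bb /= /tres /p /= !addn1.
    by move=> q; exists (@tvar L (csum (crep (crep Y bool) 'I_n) (pctx A)) (inr q)).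
  move=> [x xP].
  pose f (y : tup M (rstr F)) := feval phi' (tsum x y).
  have [||||r rP] := @dep_lim K R L M Hdep (rstr F) (nat_eseq (fun i => tres F (d i))) X x f.
  - exact: fin_rstr.
  - exact: Kn.
  - move=> n t u it iu.
    have H := id n t u (fun i j ij => etrans (esym (idx_ltn _ _)) (it i j ij))
                       (fun i j ij => etrans (esym (idx_ltn _ _)) (iu i j ij)).
    apply: (same_type_sub H) => [[y i]|[]].
    by exists (@tvar L (csum (crep Y 'I_n) (pctx A)) (inl (sval y, i))).
  - apply: (@cform_comp R L M X x (rstr F) _ phi' (fun y => tsum x y)) => -[y|y].
      by exists (@tvar L (csum (rstr F) X) (inr y)).
    by exists (@tvar L (csum (rstr F) X) (inl y)).
  have e2 : 0 < e / 2 by lra.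
  have [N NP] := rP _ e2.
  have h1 := NP N.*2; have h2 := NP N.*2.+1.
  move: h1 h2; rewrite !leEnat /= -addnn leq_addr => /(_ isT) h1.
  rewrite leqW ?leq_addr// => /(_ isT) h2.
  have := xP N; rewrite chiE -!phi'P -addnn.
  move: h1 h2; rewrite /f; set y := feval _ _; set z := feval _ _.
  rewrite !ltr_norml => /andP[h1 h1'] /andP[h2 h2'] h3.
  have : e <= Num.max (y - z) 0 by lra.
  by rewrite le_max => /orP[|]; lra.
move/avU => /(_ (finite_sumT (fin_rstr fF) (fin_rstr fF))).
apply: filterS => x; rewrite /mkset (chiE x 0%N) => /negP; rewrite -ltNge => h.
have : Num.max (feval phi (tsum x (d 0%N)) - feval phi (tsum x (d 1%N))) 0 < e by lra.
by rewrite gt_max => /andP[].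
Qed.

Lemma avoids_close (U : set_system (tup M X)) (FU : Filter U) (Y : ctx L)
    (d : nat -> tup M Y) (phi : lform (csum X Y)) (e : R) :
  avoids U -> indiscernible (params A) ltn d -> 0 < e ->
  U [set x | `|feval phi (tsum x (d 0%N)) - feval phi (tsum x (d 1%N))| < e].
Proof.
move=> avU id e0.
apply: filterS (filterI (avoids_half FU phi avU id e0) (avoids_half FU (fneg phi) avU id e0)).
by move=> x [/= h1 h2]; rewrite ltr_norml; apply/andP; split; lra.
Qed.

Variables (I : eseq (tup M X)) (HIs : small_seq K I) (HI : morley (params A) I).
Variables (B : set (elt M)) (HB : small K B) (AB : A `<=` B).
Hypothesis IB : forall i, within B (I i).

Let E (n : nat) (e : nat -> tup M X) : set (elt M) :=
  \bigcup_(k in [set k | (k < n)%N]) comps (e k).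

Let upd n (e : nat -> tup M X) (x : tup M X) : nat -> tup M X :=
  fun k => if k == n then x else e k.

(** The second clause is part of the induction: the next step needs sequences that are indiscernible
    over the entries already chosen. *)
Let good n (e : nat -> tup M X) : Prop :=
  like (params A) (suml (@idx_lt _ (idx I)) (@ord_lt n)) (sumf I (fun k : 'I_n => e k))
       (@idx_lt _ (idx I)) I /\
  forall (V : ctx L) (d : nat -> tup M V), indiscernible (params A) ltn d ->
    (forall k, within B (d k)) -> indiscernible (params (A `|` E n e)) ltn d.

Let ltb (i : idx I) : rel {j : idx I | (j < i)%O} := fun j j' => (sval j < sval j')%O.
Let Ib (i : idx I) (j : {j : idx I | (j < i)%O}) : tup M X := I (sval j).
Let ilt := @stot_idx _ (idx I).

(** Only the part of I below i is kept, because nonforking of I is about types over initial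
    segments. These sets decrease with i, so together with the nondividing conditions they can
    generate a filter. *)
Let GI n e (i : idx I) : set (tup M X) := [set x |
  like (params A) (suml (@ltb i) (@ord_lt n.+1))
       (sumf (@Ib i) (fun k : 'I_n.+1 => upd n e x k)) (@idx_lt _ (idx I)) I].

Let GIle n e i i' : (i <= i')%O -> GI n e i' `<=` GI n e i.
Proof.
move=> ii' x Gx m t t' it it'.
pose w (z : {j : idx I | (j < i)%O} + 'I_n.+1) : {j : idx I | (j < i')%O} + 'I_n.+1 :=
  match z with inl j => inl (exist _ (sval j) (lt_le_trans (proj2_sig j) ii'))
             | inr k => inr k end.
have -> : block (sumf (@Ib i) (fun k : 'I_n.+1 => upd n e x k)) t =
    block (sumf (@Ib i') (fun k : 'I_n.+1 => upd n e x k)) (w \o t).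
  by apply/functional_extensionality_dep => -[y k]; rewrite /block /=; case: (t k).
apply: Gx => // k l /it.
by rewrite /w /=; case: (t k) => ?; case: (t l) => ?.
Qed.

(** The data of a dividing condition are packed in one dependent pair so that [choice] can select
    them all together. *)
Let DivS : set (set (tup M X)) := [set S |
  exists z : {Y : ctx L & (lform (csum X Y) * tup M Y * R)%type},
  [/\ fin_ctx (projT1 z), divides (params A) (projT2 z).1.1 (projT2 z).1.2 (projT2 z).2 &
    S = [set x | ~ (feval (projT2 z).1.1 (tsum x (projT2 z).1.2) <= (projT2 z).2)]]].

(* An automorphism over A moves the nonforking type of [I (s n)] over the preceding
   elements of I to a type over the elements chosen so far. *)
Let base_ne n e (i : idx I) m (D : 'I_m -> set (tup M X)) :
  good n e -> (forall k, DivS (D k)) -> exists x, GI n e i x /\ forall k, D k x.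
Proof.
move=> [Ge _] HD.
(* The indices s 0, ..., s (n - 1) stand for the entries of e already chosen and s n for the new
   one; as s starts at i, all of them lie above the segment kept in [GI]. *)
have [s [si s0]] := inc_from ilt (@idx_nolast _ I) i.
have is_ k : (i <= s k)%O.
  by case: k => [|k]; [rewrite s0|rewrite -s0; apply/ltW/si].
pose QC := csum (pctx A) (csum (crep X {j : idx I | (j < i)%O}) (crep X 'I_n)).
pose u : tup M QC := tsum (params A) (tsum (block I (fun j : {j : idx I | (j < i)%O} => sval j))
   (block I (fun k : 'I_n => s k))).
pose v : tup M QC := tsum (params A) (tsum (block I (fun j : {j : idx I | (j < i)%O} => sval j))
   (block e (fun k : 'I_n => k : nat))).
have uv : same_type tup0 u v.
  pose Z := ({j : idx I | (j < i)%O} + 'I_n)%type.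
  pose z1 (z : Z) : idx I + 'I_n := match z with inl j => inl (sval j) | inr k => inr k end.
  pose z2 (z : Z) : idx I := match z with inl j => sval j | inr k => s k end.
  have patt z z' : suml (@idx_lt _ (idx I)) (@ord_lt n) (z1 z) (z1 z') = idx_lt (z2 z) (z2 z').
    case: z z' => [j|k] [j'|k'] //=.
    - by apply/esym; apply: lt_le_trans (proj2_sig j) (is_ k').
    - apply/esym/negP => h; have := lt_trans h (proj2_sig j').
      by rewrite ltNge is_.
    - by rewrite (stot_inj_inc stot_ltn ilt si).
  have H := like_pattern (stot_suml ilt (@stot_ord n)) ilt Ge patt.
  have {}H := same_type_sym H.
  apply: (same_type_sub H) => [w|[]].
  case: w => [a|[[x j]|[x k]]].
  - by exists (@tvar L (csum (crep X Z) (pctx A)) (inr a)).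
  - by exists (@tvar L (csum (crep X Z) (pctx A)) (inl (x, inl j))).
  - by exists (@tvar L (csum (crep X Z) (pctx A)) (inl (x, inr k))).
have sX : sm (var X) by apply: small_fin.
have sQ : sm (var QC).
  apply: small_sum => //; first exact: (small_setT K A).1.
  apply: small_sum => //; apply: small_prod => //; first exact: small_sig.
  exact: small_ord.
have [g Hg guv] := mon_hom HM sQ uv.
have gA : fixes (params A) g by move=> p; apply: (guv (inl p)).
have gI j : (j < i)%O -> actt g (I j) = I j.
  by move=> ji; apply/functional_extensionality_dep => y;
    apply: (guv (inr (inl (y, exist _ j ji)))).
have ge (k : 'I_n) : actt g (I (s k)) = e k.
  by apply/functional_extensionality_dep => y; apply: (guv (inr (inr (y, k)))).
have [g' [Hg' gK g'K]] := aut_inv Hg.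
have g'A : fixes (params A) g'.
  by move=> p; rewrite -[in LHS](gA p) gK.
(* Otherwise the conditions, pulled back along g' and still dividing over A, would show that the
   type of I (s n) forks. *)
have [a' [a't a'D]] : exists a', same_type (tsum (params A)
     (block I (fun j : {j : idx I | (j < s n)%O} => sval j))) (I (s n)) a' /\
     forall k, D k (actt g a').
  apply: contrapT => HN; apply: (HI.2 (s n)).
  have [z zP] := choice HD.
  exists m, (fun k => projT1 (z k)), (fun k => (projT2 (z k)).1.1),
    (fun k => actt g' (projT2 (z k)).1.2), (fun k => (projT2 (z k)).2); split.
  - by move=> k; case: (zP k).
  - by move=> k; case: (zP k) => _ dk _; apply: aut_divides.
  move=> a' a't; apply: contrapT => /forallNP Hk; apply: HN; exists a'; split => // k.
  case: (zP k) => _ _ -> /=; move=> h; apply: (Hk k); apply: le_trans h.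
  rewrite -(aut_feval _ _ Hg) le_eqVlt; apply/orP; left; apply/eqP; congr feval.
  by apply/functional_extensionality_dep => -[x|x]; rewrite /actt /= ?g'K.
exists (actt g a'); split => // q t t' it it'.
pose w (z : {j : idx I | (j < i)%O} + 'I_n.+1) : tup M X :=
  sumf (@Ib i) (fun k : 'I_n.+1 => if k == n :> nat then a' else I (s k)) z.
pose w' (z : {j : idx I | (j < i)%O} + 'I_n.+1) : idx I :=
  match z with inl j => sval j | inr k => s k end.
have -> : block (sumf (@Ib i) (fun k : 'I_n.+1 => upd n e (actt g a') k)) t =
    actt g (block w t).
  apply/functional_extensionality_dep => -[y k]; rewrite /block /actt /=.
  case: (t k) => [[j ji]|l] /=; first exact: (congr1 (fun h : tup M X => h y) (esym (gI j ji))).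
  rewrite /upd; case: eqP => // ln.
  have ln' : (l < n)%N by have := ltn_ord l; lia.
  exact: (congr1 (fun h : tup M X => h y) (esym (ge (Ordinal ln')))).
have wt : same_type (params A) (block w t) (block I (w' \o t)).
  apply: (same_type_sub (same_type_sym a't)) => [[y k]|p].
    rewrite /block /w /w' /=; case: (t k) => [[j ji]|l] /=.
      have js : (j < s n)%O by apply: lt_le_trans ji (is_ n).
      by exists (@tvar L (csum X (csum (pctx A) (crep X {j : idx I | (j < s n)%O})))
        (inr (inr (y, exist _ j js)))).
    case: eqP => [->|ln].
      by exists (@tvar L (csum X (csum (pctx A) (crep X {j : idx I | (j < s n)%O}))) (inl y)).
    have js : (s l < s n)%O by apply: si => /=; have := ltn_ord l; lia.
    by exists (@tvar L (csum X (csum (pctx A) (crep X {j : idx I | (j < s n)%O})))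
        (inr (inr (y, exist _ (s l) js)))).
  by exists (@tvar L (csum X (csum (pctx A) (crep X {j : idx I | (j < s n)%O}))) (inr (inl p))).
have {}wt : same_type (params A) (block w t) (block I t').
  apply: same_type_trans wt _; apply: (HI.1 q (w' \o t) t') => // k l /it /=.
  rewrite /w'; case: (t k) => [[j ji]|k']; case: (t l) => [[j' j'i]|l'] //=.
    by move=> _; apply: lt_le_trans ji (is_ l').
  by move=> kl; apply: si.
move=> phi; rewrite -wt -[RHS](aut_feval phi _ Hg); congr feval.
apply/functional_extensionality_dep => -[//|p].
exact: (esym (gA p)).
Qed.


Let base n e : set_system (tup M X) := [set S | exists i m (D : 'I_m -> set (tup M X)),
  (forall k, DivS (D k)) /\ forall x, GI n e i x -> (forall k, D k x) -> S x].

Let base_filter n e : good n e -> ProperFilter (base n e).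
Proof.
move=> ge; split.
  move=> [i [m [D [DD H]]]]; have [x [x1 x2]] := base_ne i ge DD.
  exact: (H x).
split.
- have [i] := idx_inh I; exists i, 0%N, (fun=> set0); split => // -[] //.
- move=> S S' [i [m [D [DD H]]]] [i' [m' [D' [DD' H']]]].
  exists (Order.max i i'), (m + m')%N,
    (fun k => match fintype.split k with inl j => D j | inr j => D' j end); split.
    by move=> k; case: (fintype.split k).
  move=> x Gx Dx; split.
    apply: H => [|k]; first by apply: GIle Gx; rewrite le_max lexx.
    by have := Dx (unsplit (inl k)); rewrite unsplitK.
  apply: H' => [|k]; first by apply: GIle Gx; rewrite le_max lexx orbT.
  by have := Dx (unsplit (inr k)); rewrite unsplitK.
- move=> S S' SS' [i [m [D [DD H]]]]; exists i, m, D; split => // x x1 x2.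
  exact/SS'/H.
Qed.

(** An ultrafilter containing the base is a global nonforking type prolonging I and the entries of e
    chosen so far; x realizes it over B and these entries. *)
Let good_step n e : good n e -> exists x, good n.+1 (upd n e x).
Proof.
move=> ge; have FF := base_filter ge.
have [U [FU bU]] := ultraFilterLemma FF.
have FU' := @ultra_proper _ U FU.
have UG i : U (GI n e i).
  by apply: bU; exists i, 0%N, (fun=> set0); split => // -[].
have avU : avoids U.
  move=> Y phi b r fY db; apply: bU.
  have [i] := idx_inh I; exists i, 1%N, (fun=> [set x | ~ feval phi (tsum x b) <= r]).
  split=> [_|x _ /(_ ord0) //].
  by exists (existT _ Y (phi, b, r)); split.
have sX : sm (var X) by apply: small_fin.
pose Bn := B `|` E n e.
have sBn : small K Bn.
  apply: (small_setU Kn Kp) => //.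
  have h : E n e `<=` comps (fun v : var (crep X nat) => e v.2 v.1).
    by move=> _ [k kn [y _ <-]]; exists (y, k).
  by apply: (small_sub h); apply: small_image => //; apply: small_prod.
have [x xP] := realize HM (params Bn) FU sX ((small_setT K Bn).1 sBn).
exists x; split.
  move=> q t t' it it' phi.
  have [i0] := idx_inh I.
  have [ub ubP] := ub_fin ilt (@idx_nolast _ I) (idx_inh I)
    (fun k : 'I_q => match t k with inl j => j | inr _ => i0 end).
  pose G (x : tup M X) := tsum (block (sumf I (fun k : 'I_n.+1 => upd n e x k)) t) (params A).
  apply: (ultra_real_const FU' xP (f := fun x => feval phi (G x))).
    apply: cform_set => -[[y k]|p].
      rewrite /= /block /=; case: (t k) => [j|l] /=.
        by right; exists (I j y); split => //; left; apply: (IB j).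
      rewrite /upd; case: eqP => ln; first by left; exists (@tvar L X y).
      right; exists (e l y); split => //; right; exists (nat_of_ord l).
        by have := ltn_ord l; rewrite /=; lia.
      by exists y.
    right; exists (params A p); split => //; left; apply: AB.
    exact: within_params.
  move=> eps eps0; apply: filterS (UG ub) => x' Gx' /=.
  suff -> : feval phi (G x') = feval phi (tsum (block I t') (params A)).
    by rewrite subrr normr0.
  have Hz k : exists z : {j : idx I | (j < ub)%O} + 'I_n.+1,
      t k = match z with inl j => inl (sval j) | inr l => inr l end.
    by have := ubP k; case: (t k) => [j jub|l _]; [exists (inl (exist _ j jub))|exists (inr l)].
  have [z zP] := choice Hz.
  rewrite /G; have -> : block (sumf I (fun k : 'I_n.+1 => upd n e x' k)) t =
      block (sumf (@Ib ub) (fun k : 'I_n.+1 => upd n e x' k)) z.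
    apply/functional_extensionality_dep => -[y k]; rewrite /block /= zP.
    by case: (z k).
  apply: (Gx' q z t' _ it') => k l /it; rewrite !zP.
  by case: (z k) => ?; case: (z l) => ?.
move=> V d id dB.
have id' := ge.2 V d id dB.
pose An := A `|` E n e.
have AnB : An `<=` Bn by apply: setSU.
suff far q (p : nat -> 'I_q -> nat) : (forall i, increasing (@ord_lt q) ltn (p i)) ->
     (forall i j z z', (i < j)%N -> ltn (p i z) (p j z')) ->
     same_type (tsum (params An) x) (block d (p 0%N)) (block d (p 1%N)).
  apply: (indisc_by_far stot_ltn) => [k||q p p1 p2].
  - by exists k.+1 => /=.
  - exact: (inhabits 0%N).
  apply: same_typeS (same_type_add (far q p p1 p2)) => el [Ael|[k kn ek]].
    by left; left.
  move: ek; rewrite /upd; case: eqP => [_ ek|kn' ek]; first by right.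
  by left; right; exists k => //=; move: kn => /=; lia.
move=> p1 p2 phi.
have iD := indisc_blocks_inc stot_ltn id' p1 p2.
(* The parameters An are attached unchanged to every block. The result is A-indiscernible because d
   is indiscernible over An, so [avoids_close], which is about indiscernibility over A, covers
   formulas that also use the earlier entries of e. *)
pose Y := csum (crep V 'I_q) (pctx An).
pose dd k : tup M Y := tsum (block d (p k)) (params An).
have idd : indiscernible (params A) ltn dd.
  move=> m t u it iu; apply: (same_type_sub (iD m t u it iu)).
    move=> [[y|y] k].
      by exists (@tvar L (csum (crep (crep V 'I_q) 'I_m) (pctx An)) (inl (y, k))).
    by exists (@tvar L (csum (crep (crep V 'I_q) 'I_m) (pctx An)) (inr y)).
  move=> [el Ael].
  by exists (@tvar L (csum (crep (crep V 'I_q) 'I_m) (pctx An)) (inr (exist _ el (or_introl Ael)))).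
pose W := csum (crep V 'I_q) (csum (pctx An) X).
pose rr : subst W (csum X Y) := fun w =>
  match w return lterm (csum X Y) (vsort (c := W) w) with
  | inl v => @tvar L (csum X Y) (inr (inl v))
  | inr (inl a) => @tvar L (csum X Y) (inr (inr a))
  | inr (inr y) => @tvar L (csum X Y) (inl y) end.
have rrE k x' : feval (fsub phi rr) (tsum x' (dd k)) =
    feval phi (tsum (block d (p k)) (tsum (params An) x')).
  rewrite feval_sub; congr feval.
  by apply/functional_extensionality_dep => -[v|[a|y]].
have cf k : cform (params Bn)
    (fun x' => feval phi (tsum (block d (p k)) (tsum (params An) x'))).
  apply: cform_set => -[[v l]|[a|y]] /=.
  - by right; exists (block d (p k) (v, l)); split => //; left; apply: (dB (p k l)).
  - by right; exists (params An a); split => //; apply: AnB; apply: within_params.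
  - by left; exists (@tvar L X y).
apply: (ultra_real_eq FU' xP (cf 0%N) (cf 1%N)) => eps eps0.
have := avoids_close (@filter_filter _ _ FU') (fsub phi rr) avU idd eps0.
by apply: filterS => x'; rewrite /mkset !rrE.
Qed.

(** Each instance of the two clauses involves finitely many entries of e, so both pass from the
    finite stages to the whole sequence. *)
Lemma morley_ext : exists e : nat -> tup M X,
  like (params A) (suml (@idx_lt _ (idx I)) ltn) (sumf I e) (@idx_lt _ (idx I)) I /\
  forall (V : ctx L) (d : nat -> tup M V), indiscernible (params A) ltn d ->
    (forall k, within B (d k)) ->
    indiscernible (params (A `|` \bigcup_k comps (e k))) ltn d.
Proof.
have [e He] : exists e, forall n, good n e.
  apply: dep_choice_nat.
  - move=> n e e' ee' [H1 H2]; split.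
      suff <- : (fun k : 'I_n => e k) = (fun k : 'I_n => e' k) by [].
      by apply/funext => k; rewrite ee'.
    suff <- : E n e = E n e' by [].
    by apply/seteqP; split => el [k /= kn]; [rewrite ee'//|rewrite -ee'//]; exists k.
  - have [i] := idx_inh I; exists (fun=> I i); split.
      move=> q t t' it it' phi.
      pose t0 k := match t k with inl j => j | inr _ => i end.
      have tE k : t k = inl (t0 k) by rewrite /t0; case: (t k) => // -[].
      have -> : block (sumf I (fun _ : 'I_0 => I i)) t = block I t0.
        by apply/functional_extensionality_dep => -[y k]; rewrite /block /= tE.
      by apply: (HI.1 q t0 t' _ it') => k l /it; rewrite !tE.
    move=> V d id _ q t u it iu.
    apply: same_typeS (id q t u it iu) => el [//|[k //]].
  - exact: good_step.
exists e; split.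
  move=> q t t' it it' phi.
  have [N NP] := @ub_fin _ ltn stot_ltn (fun n => ex_intro _ n.+1 (ltnSn n))
    (inhabits 0%N) _ (fun i : 'I_q => match t i with inr k => k | inl _ => 0%N end).
  have Hz k : exists z : idx I + 'I_N,
      t k = match z with inl j => inl j | inr l => inr (nat_of_ord l) end.
    by have := NP k; case: (t k) => [j _|l lN]; [exists (inl j)|exists (inr (Ordinal lN))].
  have [z zP] := choice Hz.
  have -> : block (sumf I e) t = block (sumf I (fun k : 'I_N => e k)) z.
    apply/functional_extensionality_dep => -[y k]; rewrite /block /= zP.
    by case: (z k).
  apply: ((He N).1 q z t' _ it') => k l /it; rewrite !zP.
  by case: (z k) => ?; case: (z l) => ?.
move=> V d id dB q t u it iu; apply: same_type_fin_params => F fF.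
have Hn (el : var (pctx (A `|` \bigcup_k comps (e k)))) : exists n : nat,
    (A `|` E n.+1 e) (sval el).
  case: el => el Hel; have [Ael|[k _ ek]] := Hel; first by exists 0%N; left.
  by exists k; right; exists k => /=.
have [h hP] := choice Hn; have [N NP] := fin_bound h fF.
apply: (same_type_set ((He N).2 V d id dB q t u it iu)).
  by move=> v; left; exists (tvar v).
move=> [[[s b] Hb] Fel]; have lN := NP _ Fel; move: (hP (exist _ (existT _ s b) Hb)) lN.
by case=> [Ab|[k /= kn ek]] lN; [left|right; exists k => //=; exact: leq_trans kn lN].
Qed.

End Morley.

Lemma existT_inj (T : Type) (P : T -> Type) (x : T) (a b : P x) :
  existT P x a = existT P x b -> a = b.
Proof.
by move=> e; have := projT2_eq e; rewrite (Prop_irrelevance (projT1_eq e) erefl).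
Qed.

(** * Lascar strong types *)

Section Coding.
Variables (L : lang) (T : Type).

Local Notation code := (GenTree.tree (lsort L + fnsym L + prsym L + T)).

Definition lf_sort (s : lsort L) : code := GenTree.Leaf (inl (inl (inl s))).
Definition lf_fn (f : fnsym L) : code := GenTree.Leaf (inl (inl (inr f))).
Definition lf_pr (p : prsym L) : code := GenTree.Leaf (inl (inr p)).

(** Subformulas live over varying contexts, so a code is computed relative to an encoding e of the
    variables, which is extended under each quantifier. *)
Fixpoint tcode (V : ctx L) (e : var V -> code) s (t : lterm V s) : code :=
  match t with
  | tvar v => GenTree.Node 0 [:: e v]
  | tapp f u => GenTree.Node 1 (lf_fn f :: [seq tcode e (u i) | i <- enum 'I_(farity f)])
  end.

Definition ecode (V : ctx L) s (e : var V -> code) : var (cext V s) -> code :=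
  fun o => if o is Some x then GenTree.Node 10 [:: e x] else GenTree.Node 11 [::].

Fixpoint fcode (V : ctx L) (phi : lform V) : (var V -> code) -> code :=
  match phi with
  | fdist s t u => fun e => GenTree.Node 2 [:: lf_sort s; tcode e t; tcode e u]
  | fpred P u => fun e =>
      GenTree.Node 3 (lf_pr P :: [seq tcode e (u i) | i <- enum 'I_(parity P)])
  | fneg p => fun e => GenTree.Node 4 [:: fcode p e]
  | fmonus p q => fun e => GenTree.Node 5 [:: fcode p e; fcode q e]
  | fhalf _ p => fun e => GenTree.Node 6 [:: fcode p e]
  | fsup s p => fun e => GenTree.Node 7 [:: lf_sort s; fcode p (@ecode V s e)]
  end.

Lemma map_enum_inj n (U : Type) (F G : 'I_n -> U) :
  [seq F i | i <- enum 'I_n] = [seq G i | i <- enum 'I_n] -> forall i, F i = G i.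
Proof. by move/eq_in_map => H i; apply: H; rewrite mem_enum. Qed.

(** The equality is between dependent pairs because the sorts of t and t' are not known to agree
    beforehand. *)
Lemma tcode_inj (V : ctx L) (e : var V -> code) s (t : lterm V s) s' (t' : lterm V s') :
  injective e -> tcode e t = tcode e t' -> existT (lterm V) s t = existT (lterm V) s' t'.
Proof.
move=> ei; elim: t s' t' => [v|f u IH] s' [v'|f' u'] //= [].
  by move/ei => ->.
move=> ff'; subst f' => /map_enum_inj H.
congr existT; congr tapp; apply/functional_extensionality_dep => i.
by apply: existT_inj; apply: IH.
Qed.

Lemma fcode_inj (V : ctx L) (phi psi : lform V) (e : var V -> code) :
  injective e -> fcode phi e = fcode psi e -> phi = psi.
Proof.
move=> ei; elim: phi e ei psi => {V} [V s t u|V P u|V p IH|V p IHp q IHq|V h p IH|V s p IH]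
  e ei [s' t' u'|P' u'|p'|p' q'|h' p'|s' p'] //= [].
- move=> ss'; subst s' => /(tcode_inj ei) tt' /(tcode_inj ei) uu'.
  by rewrite (existT_inj tt') (existT_inj uu').
- move=> PP'; subst P' => /map_enum_inj H; congr fpred.
  by apply/functional_extensionality_dep => i; apply: existT_inj; apply: tcode_inj (H i).
- by move/(IH _ ei) => ->.
- by move=> /(IHp _ ei) -> /(IHq _ ei) ->.
- by move/(IH _ ei) => ->; rewrite (Prop_irrelevance h h').
- move=> ss'; subst s'; move/IH => -> //.
  by move=> [x|] [y|] //= [/ei ->].
Qed.

End Coding.

(** * Downward Loewenheim-Skolem for tuples *)

Section Loewenheim.
Variables (K : Type) (R : realType) (L : lang) (M : struct R L).
Hypothesis HM : monster K M.

Local Notation sm T := (small K [set: T]).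
Let Kn := mon_nat HM.
Let Kp := mon_pow HM.

Lemma small_code (T : Type) :
  sm T -> sm (GenTree.tree (lsort L + fnsym L + prsym L + T)).
Proof.
move=> sT; have s1 := mon_sort HM; have s2 := mon_fnsym HM; have s3 := mon_prsym HM.
by apply: small_tree => //; do 3!apply: small_sum => //.
Qed.

Lemma small_lform (V : ctx L) : sm (var V) -> sm (lform V).
Proof.
move=> sV; apply: small_embeds (small_code sV).
pose e (v : var V) : GenTree.tree (lsort L + fnsym L + prsym L + var V) :=
  GenTree.Leaf (inr v).
by exists (fun phi => fcode phi e) => phi psi; apply: fcode_inj => x y [].
Qed.

Variables (A : set (elt M)) (HA : small K A) (V : ctx L) (HV : sm (var V)).

Definition conds (N : set (elt M)) : Type := seq (lform (csum V (pctx N)) * rat).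

Definition holds (N : set (elt M)) (D : conds N) (x : tup M V) : bool :=
  all (fun q => feval q.1 (tsum x (params N)) <= ratr q.2) D.

(** A Tarski-Vaught test for tuples and finite sets of closed conditions. Rational bounds are enough
    to approximate all values, and they can be coded by natural numbers. *)
Definition ls_closed (N : set (elt M)) : Prop :=
  forall (D : conds N) (u : tup M V), holds D u -> exists2 x, within N x & holds D x.

Let wit_ex (N : set (elt M)) (D : conds N) :
  exists x : tup M V, (exists u, holds D u) -> holds D x.
Proof.
have [[u uP]|nu] := pselect (exists u, holds D u); first by exists u.
have H (v : var V) : exists x : sdom M (vsort v), True by have [x] := dom_inh M (vsort v); exists x.
by exists (fun v => sval (cid (H v))).
Qed.

Let wit (N : set (elt M)) (D : conds N) : tup M V := sval (cid (wit_ex D)).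

Let next (N : set (elt M)) : set (elt M) := N `|` \bigcup_(D in [set: conds N]) comps (wit D).

Let N_ := fix N_ k := if k is k'.+1 then next (N_ k') else A.
Let N := \bigcup_k N_ k.

Let base := ({e | A e} + var V)%type.
Local Notation code := (GenTree.tree (lsort L + fnsym L + prsym L + base)).

(** An element new at stage k + 1 is a coordinate of a chosen witness, hence determined by a code of
    the conditions and of the coordinate. The node labels only keep the cases apart. *)
Let N_code k : embeds {e | N_ k e} code.
Proof.
elim: k => [|k [c ci]] /=.
  exists (fun e => GenTree.Leaf (inr (inl e))) => x y [] //.
pose ev (v : var (csum V (pctx (N_ k)))) : code :=
  match v with inl v => GenTree.Node 12 [:: GenTree.Leaf (inr (inr v))]
             | inr e => GenTree.Node 13 [:: c e] end.
have evi : injective ev by move=> [x|x] [y|y] //= [] => [|/ci] ->.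
pose cD (D : conds (N_ k)) : code :=
  GenTree.Node 14 [seq GenTree.Node (pickle q.2) [:: fcode q.1 ev] | q <- D].
have cDi : injective cD.
  move=> D D' [] H; apply: inj_map H => -[p q] [p' q'] /= [].
  by move=> /(pcan_inj pickleK) -> /(fcode_inj evi) ->.
move: cD cDi => cD cDi.
have H (e : {e | next (N_ k) e}) : exists z : {e | N_ k e} + conds (N_ k) * var V,
    match z with inl e' => sval e' = sval e
               | inr (D, v) => sval e = existT _ (vsort v) (wit D v) end.
  case: e => e He; have [Ne|[D _ [v _ ve]]] := He; first by exists (inl (exist _ e Ne)).
  by exists (inr (D, v)).
have [z zP] := choice H.
exists (fun e => match z e with inl e' => GenTree.Node 20 [:: c e']
  | inr (D, v) => GenTree.Node 21 [:: cD D; GenTree.Leaf (inr (inr v))] end).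
move=> x y; move: (zP x) (zP y); case: (z x) => [x'|[D v]]; case: (z y) => [y'|[D' v']] //=.
  by move=> hx hy [/ci xy]; apply: eq_sig_hprop => //; rewrite -hx -hy xy.
by move=> hx hy [/cDi DD' vv']; subst D' v'; apply: eq_sig_hprop => //; rewrite hx hy.
Qed.

Let small_N : small K N.
Proof.
apply/small_setT.
have sc : sm code.
  by apply: small_code; apply: small_sum => //; exact: (small_setT K A).1.
apply: small_embeds sc.
pose c k := sval (cid (N_code k)).
have ci k : injective (c k) := svalP (cid (N_code k)).
have H (e : {e | N e}) : exists k, N_ k (sval e) by case: e => e Ne; have [k _ Nk] := Ne; exists k.
have [h hP] := choice H.
exists (fun e => GenTree.Node (h e) [:: c (h e) (exist _ (sval e) (hP e))]).
move=> x y [e]; move: (hP x) (hP y); rewrite e => hx hy /ci /(congr1 sval) /= xy.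
by apply: eq_sig_hprop.
Qed.

Let N_le k k' : (k <= k')%N -> N_ k `<=` N_ k'.
Proof.
move=> /subnKC <-; elim: (k' - k)%N => [|m IH]; first by rewrite addn0.
by rewrite addnS => x /IH Nx; left.
Qed.

Let form_N (phi : lform (csum V (pctx N))) : exists k0, forall k, (k0 <= k)%N ->
  exists phi' : lform (csum V (pctx (N_ k))),
    forall x, feval phi' (tsum x (params (N_ k))) = feval phi (tsum x (params N)).
Proof.
have [F fF [phi' phi'P]] := form_support_r M phi.
have H (e : {e | N e}) : exists k, N_ k (sval e) by case: e => e Ne; have [k _ Nk] := Ne; exists k.
have [h hP] := choice H.
have [k0 k0P] := fin_bound h fF.
exists k0 => k k0k.
have HF (e : var (rstr F)) : N_ k (sval (sval e)).
  by case: e => e Fe /=; apply: N_le (hP e); apply: leq_trans k0k; apply/ltnW/k0P.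
pose r : subst (csum V (rstr F)) (csum V (pctx (N_ k))) := fun w =>
  match w return lterm (csum V (pctx (N_ k))) (vsort (c := csum V (rstr F)) w) with
  | inl v => @tvar L (csum V (pctx (N_ k))) (inl v)
  | inr e => @tvar L (csum V (pctx (N_ k))) (inr (exist _ (sval (sval e)) (HF e))) end.
exists (fsub phi' r) => x; rewrite feval_sub -phi'P; congr feval.
by apply/functional_extensionality_dep => -[v|e].
Qed.

Let conds_N (D : conds N) : exists k0, forall k, (k0 <= k)%N ->
  exists D' : conds (N_ k), forall x, holds D' x = holds D x.
Proof.
elim: D => [|[phi q] D [k1 IH]]; first by exists 0%N => k _; exists [::].
have [k2 H] := form_N phi; exists (maxn k1 k2) => k.
rewrite geq_max => /andP[/IH[D' D'P] /H[phi' phi'P]].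
exists ((phi', q) :: D') => x; rewrite /holds /= phi'P; congr andb; exact: D'P.
Qed.

(* The sizes of the stages are bounded by that of one fixed set of finite trees:
   a union of countably many small sets need not be small, as |K| may have countable
   cofinality. *)
Lemma loewenheim : exists N, [/\ A `<=` N, small K N & ls_closed N].
Proof.
exists N; split; [by move=> x Ax; exists 0%N|exact: small_N|].
move=> D u Du; have [k /(_ k (leqnn k))[D' D'P]] := conds_N D.
exists (wit D').
  by move=> v; exists k.+1 => //=; right; exists D' => //; exists v.
rewrite -D'P /wit; case: (cid _) => x xP /=; apply: xP.
by exists u; rewrite D'P.
Qed.

End Loewenheim.

Lemma indisc_step (R : realType) (L : lang) (M : struct R L) (P : ctx L) (c : tup M P)
    (V : ctx L) (O : Type) (lt : rel O) (w : O -> tup M V) (i j : O) :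
  irreflexive lt -> indiscernible c lt w -> same_type c (w i) (w j).
Proof.
move=> irr iw.
have i1 k : increasing (@ord_lt 1) lt (fun=> k) by move=> a b; rewrite /ord_lt !ord1.
apply: (same_type_sub (iw 1%N _ _ (i1 i) (i1 j))) => [x|p].
  by exists (@tvar L (csum (crep V 'I_1) P) (inl (x, ord0))).
by exists (@tvar L (csum (crep V 'I_1) P) (inr p)).
Qed.

(** * Lascar equivalence as connection by indiscernible sequences *)

Section LascarChain.
Variables (K : Type) (R : realType) (L : lang) (M : struct R L).
Hypothesis HM : monster K M.

Local Notation sm T := (small K [set: T]).
Let Kn := mon_nat HM.
Let Kp := mon_pow HM.

Variables (A : set (elt M)) (HA : small K A) (V : ctx L) (HV : sm (var V)).

(** Connectedness in the Lascar graph, whose edges join the first two terms of an A-indiscernible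
    sequence. *)
Inductive chain : tup M V -> tup M V -> Prop :=
| chain_step w : indiscernible (params A) ltn w -> chain (w 0%N) (w 1%N)
| chain_refl u : chain u u
| chain_sym u v : chain u v -> chain v u
| chain_trans u v w : chain u v -> chain v w -> chain u w.

(** The type of u over N is approximately finitely satisfied by tuples from N, so it extends to an
    ultrafilter concentrated on such tuples: a global coheir. *)
Lemma ultra_real_closed (N : set (elt M)) (u : tup M V) : ls_closed V N ->
  exists W : set_system (tup M V),
    [/\ UltraFilter W, W [set x | dclo (params N) x] & ultra_real (params N) W u].
Proof.
move=> Ncl.
pose F : set_system (tup M V) := [set S | exists D : conds V N, holds D u /\
  forall x, within N x -> holds D x -> S x].
have FF : ProperFilter F.
  split.
    by move=> [D [Du H]]; have [x Nx Dx] := Ncl D u Du; apply: (H x).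
  split.
  - by exists [::].
  - move=> S S' [D [Du H]] [D' [Du' H']]; exists (D ++ D').
    rewrite /holds all_cat; split; first exact/andP.
    by move=> x Nx; rewrite all_cat => /andP[Dx Dx']; split; [exact: H|exact: H'].
  - by move=> S S' SS' [D [Du H]]; exists D; split => // x Nx Dx; exact/SS'/H.
have [W [UW FW]] := ultraFilterLemma FF; exists W; split => //.
  by apply: FW; exists [::]; split => // x Nx _; exact: dclo_within.
move=> f [phi phiP] e e0; apply: FW.
(* A rational slightly above f u and one slightly above 1 - f u together confine f to within e of f
   u. *)
have [q] := @rat_in_itvoo R (f u) (f u + e) ltac:(lra).
have [q'] := @rat_in_itvoo R (1 - f u) (1 - f u + e) ltac:(lra).
rewrite !in_itv /= => /andP[q1 q2] /andP[q1' q2'].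
exists [:: (phi, q); (fneg phi, q')]; rewrite /holds /= -!phiP; split.
  by rewrite !ltW.
move=> x _; rewrite -!phiP andbT => /andP[h1 h2].
by rewrite ltr_norml; apply/andP; split; lra.
Qed.

(* A coheir sequence over N of the common type of u and v, prolonged to the left by
   either u or v, is indiscernible. *)
Lemma chain_same_type (N : set (elt M)) (u v : tup M V) :
  A `<=` N -> small K N -> ls_closed V N -> same_type (params N) u v -> chain u v.
Proof.
move=> AN sN Ncl uv; have [W [UW Wd Wu]] := ultra_real_closed u Ncl.
have FW := @ultra_proper _ W UW.
have Wv : ultra_real (params N) W v.
  move=> f [phi phiP] e e0; have -> : f v = f u by rewrite !phiP uv.
  by apply: Wu => //; exists phi.
have sc : sm (var (csum (pctx N) (csum V V))).
  have sN' := (small_setT K N).1 sN.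
  by do 2!apply: small_sum => //.
have [s sP] := coheir_exists HM (tsum (params N) (tsum u v)) UW HV sc.
suff H z : z = u \/ z = v -> chain z (s 0%N).
  apply: chain_trans (H u _) _; first by left.
  by apply: chain_sym; apply: H; right.
move=> zuv; pose sz k := if k is k'.+1 then s k' else z.
have -> : z = sz 0%N by []; have -> : s 0%N = sz 1%N by [].
apply: chain_step.
suff isz : indiscernible (params N) ltn sz.
  by move=> n t u' it iu; apply: same_typeS AN (isz n t u' it iu).
apply: (coheir_indisc FW Wd) => -[|k] /=.
  have Wz : ultra_real (params N) W z by case: zuv => ->.
  by apply: ultra_real_sub Wz => -[e|[x [j]]] //; exists (@tvar L (pctx N) e).
apply: ultra_real_sub (sP k) => -[e|[x [j jk]]].
  by exists (@tvar L (csum (csum (pctx N) (csum V V)) (crep V {j | (j < k)%N})) (inl (inl e))).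
case: j jk => [|j] jk.
  case: zuv => zE.
    exists (@tvar L (csum (csum (pctx N) (csum V V)) (crep V {j | (j < k)%N}))
      (inl (inr (inl x)))).
    by rewrite /= /below /block /= zE.
  exists (@tvar L (csum (csum (pctx N) (csum V V)) (crep V {j | (j < k)%N}))
    (inl (inr (inr x)))).
  by rewrite /= /below /block /= zE.
by exists (@tvar L (csum (csum (pctx N) (csum V V)) (crep V {j | (j < k)%N}))
  (inr (x, exist _ j jk))).
Qed.

(** By [chain_same_type] the type over a small closed N determines the class, and such a type is
    coded by a set of formulas with rational bounds; one representative per set suffices. *)
Lemma chain_bounded : bounded_invariant K (params A) chain.
Proof.
split.
- exact: chain_refl.
- exact: chain_sym.
- exact: chain_trans.
- move=> g u v Hg gA; elim=> {u v} [w iw|u|u v _ IH|u v w _ IH1 _ IH2].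
  + have : indiscernible (params A) ltn (fun i => actt g (w i)).
      by rewrite -(actt_fix gA); apply: aut_indisc.
    exact: chain_step.
  + exact: chain_refl.
  + exact: chain_sym.
  + exact: chain_trans IH1 IH2.
have [N [AN sN Ncl]] := loewenheim HM HA HV.
have sT : sm (set (lform (csum V (pctx N)) * rat)).
  apply: small_set => //; apply: small_prod => //.
    by apply: (small_lform HM); apply: small_sum => //; exact: (small_setT K N).1.
  by apply: (small_embeds _ Kn); exists pickle; apply: pcan_inj pickleK.
pose tp (u : tup M V) := [set q : lform (csum V (pctx N)) * rat |
  feval q.1 (tsum u (params N)) <= ratr q.2].
have H (T : set (lform (csum V (pctx N)) * rat)) : exists u, (exists v, tp v = T) -> tp u = T.
  have [[v vT]|nT] := pselect (exists v, tp v = T); first by exists v.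
  have H (x : var V) : exists y : sdom M (vsort x), True.
    by have [y] := dom_inh M (vsort x); exists y.
  by exists (fun x => sval (cid (H x))).
have [rep repP] := choice H.
exists (range rep); first exact: small_image.
move=> u; exists (rep (tp u)); first by exists (tp u).
apply: (chain_same_type AN sN Ncl) => phi.
have e : tp (rep (tp u)) = tp u by apply: repP; exists u.
have le (v w : tup M V) : tp v = tp w ->
    feval phi (tsum v (params N)) <= feval phi (tsum w (params N)).
  move=> vw; rewrite leNgt; apply/negP => /rat_in_itvoo[q]; rewrite in_itv /= => /andP[q1 q2].
  have : tp w (phi, q) by rewrite /tp /= ltW.
  by rewrite -vw /tp /=; lra.
by apply/eqP; rewrite eq_le !le.
Qed.

Lemma lstp_chain (u v : tup M V) : same_lstp K (params A) u v -> chain u v.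
Proof. by apply; exact: chain_bounded. Qed.

Definition stabilizes (B E : set (elt M)) : Prop :=
  forall (Y : ctx L) (d : nat -> tup M Y), indiscernible (params A) ltn d ->
    (forall k, within B (d k)) -> indiscernible (params (A `|` E)) ltn d.

Lemma stabilizesS (B B' E : set (elt M)) :
  B `<=` B' -> stabilizes B' E -> stabilizes B E.
Proof. by move=> BB' H Y d id dB; apply: H => // k; apply: withinS BB' (dB k). Qed.

(** B collects the sequences used by the finitely many steps. They stay indiscernible over A and E,
    so their first two terms have the same type there. *)
Lemma chain_stabilized (u v : tup M V) : chain u v -> exists2 B, small K B &
  forall E, stabilizes B E -> same_type (params (A `|` E)) u v.
Proof.
elim=> {u v} [w iw|u|u v _ [B sB IH]|u v w _ [B sB IH] _ [B' sB' IH']].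
- exists (comps (fun x : var (crep V nat) => w x.2 x.1)).
    by apply: small_image; apply: small_prod.
  move=> E /(_ _ _ iw) H; apply: (@indisc_step _ _ _ _ _ _ _ ltn); first exact: ltnn.
  by apply: H => k x; exists (x, k).
- exists set0; last by move=> E _; exact: same_type_refl.
  by apply/small_setT; apply: small_embeds Kn; exists (fun=> 0%N) => -[].
- by exists B => // E /IH /same_type_sym.
- exists (B `|` B'); first exact: small_setU.
  move=> E HE; apply: same_type_trans (IH E _) (IH' E _).
    exact: stabilizesS HE.
  exact: stabilizesS HE.
Qed.

End LascarChain.

(** * Symmetry of the type of I *)

Section Symmetry.
Variables (K : Type) (R : realType) (L : lang) (M : struct R L).
Hypotheses (HM : monster K M) (Hdep : dependent K M).
Variables (A : set (elt M)) (HA : small K A) (X : ctx L) (HX : fin_ctx X).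
Variables (I : eseq (tup M X)) (HIs : small_seq K I) (HI : morley (params A) I).
Hypothesis HEv : Ev K A I = Av I [set: elt M].

Local Notation sm T := (small K [set: T]).
Let Kn := mon_nat HM.
Let Kp := mon_pow HM.
Let sX : sm (var X) := small_fin Kn HX.
Let ilt := @stot_idx _ (idx I).
Local Notation ltI := (@idx_lt _ (idx I)).

Lemma lim_endE d (O : orderType d) (f : O -> R) (r : R) :
  inhabited O -> has_lim f r -> lim_end f = r.
Proof.
move=> iO fr; apply: (has_lim_uniq iO _ fr).
by apply: (@xgetPex _ 0 [set r | has_lim f r]); exists r.
Qed.

(** [Ev] is an [xget], so its value provides a sequence J only once its defining set is known to be
    nonempty. An omega-subsequence of I followed by the sequence of [ev_determined_exists] shows
    this. *)
Lemma Ev_witness (phi : lform (csum X (pctx [set: elt M]))) (r : R) :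
  has_lim (fun i => feval phi (tsum (I i) (params [set: elt M]))) r ->
  exists J : eseq (tup M X),
    [/\ small_seq K J, indisc_seq (params A) J, seq_lstp K (params A) I J,
        ev_determines K (params A) J (params [set: elt M]) phi
      & has_lim (fun i : idx J => feval phi (tsum (J i) (params [set: elt M]))) r].
Proof.
move=> Ir; have : Ev K A I phi = r by rewrite HEv; exact: lim_endE (idx_inh I) Ir.
rewrite /Ev; set S := [set r | _] => <-; apply: (@xgetPex _ 0 S).
have [i0] := idx_inh I.
have [s [si _]] := inc_from ilt (@idx_nolast _ I) i0.
have is_ : indiscernible (params A) ltn (I \o s) := indisc_comp si HI.1.
have [e [e1 e2 [r' e3]]] :=
  ev_determined_exists HM Hdep HA HX is_ (params [set: elt M]) phi.
exists r', (omega2_eseq (I \o s) e); split => //.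
  by apply: small_prod => //; apply: small_bool.
exists s, (fun n => (false, n) : omega2); split => //.
by move=> F [Frefl _ _ _ _]; apply: Frefl.
Qed.

(** [stabilizes] speaks of omega-sequences; other orders reduce to these through successive blocks,
    whose coordinates are still in B. *)
Lemma stabilized_indisc (B E : set (elt M)) (V : ctx L) (O : Type) (lt : rel O)
    (a : O -> tup M V) :
  stot lt -> no_last lt -> inhabited O -> stabilizes A B E ->
  indiscernible (params A) lt a -> (forall i, within B (a i)) ->
  indiscernible (params (A `|` E)) lt a.
Proof.
move=> lto nl iO BE ia aB; apply: (indisc_by_far lto nl iO) => n p p1 p2.
apply: (@indisc_step _ _ _ _ _ _ _ ltn (fun k => block a (p k))); first exact: ltnn.
apply: BE; first exact: indisc_blocks_inc lto ia p1 p2.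
by move=> k [x i]; exact: (aB (p k i)).
Qed.

(* J and I have a common Lascar type, witnessed by f0 and g0; so e continues J as it
   continues I. *)
Lemma Ev_stabilized (J : eseq (tup M X)) (e : nat -> tup M X) (f0 : nat -> idx I)
    (g0 : nat -> idx J) :
  let E := \bigcup_k comps (e k) in
  increasing ltn ltI f0 -> increasing ltn (@idx_lt _ (idx J)) g0 ->
  same_type (params (A `|` E)) (block I f0) (block J g0) ->
  indiscernible (params (A `|` E)) (@idx_lt _ (idx J)) J ->
  like (params A) (suml ltI ltn) (sumf I e) ltI I ->
  like (params A) (suml (@idx_lt _ (idx J)) ltn) (sumf J e) ltI I.
Proof.
move=> E f0i g0i fg iJ Ie q t t' it it'.
(* The positions of t that fall in J. Over A and E they are moved to entries of J along g0 and then
   to entries of I along f0, while the positions in e stay fixed. *)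
pose Z := {i : 'I_q | exists j, t i = inl j}.
have Hz (z : Z) : exists j, t (sval z) = inl j by case: z.
have [jz jzP] := choice Hz.
have [irr tr tot] := @stot_idx _ (idx J).
have h1 : same_type (params (A `|` E)) (block J jz) (block J (fun z : Z => g0 (sval z))).
  apply: (indisc_pattern (@stot_idx _ (idx J)) iJ) => z z'.
  rewrite (stot_inj_inc stot_ltn (@stot_idx _ (idx J)) g0i).
  have := stot_inj_inc (@stot_ord q) (stot_suml (@stot_idx _ (idx J)) stot_ltn) it
    (sval z) (sval z').
  by rewrite !jzP.
have h2 : same_type (params (A `|` E)) (block J (fun z : Z => g0 (sval z)))
    (block I (fun z : Z => f0 (sval z))).
  apply: (same_type_sub (same_type_sym fg)) => [[x z]|p].
    by exists (@tvar L (csum (crep X nat) (pctx (A `|` E))) (inl (x, nat_of_ord (sval z)))).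
  by exists (@tvar L (csum (crep X nat) (pctx (A `|` E))) (inr p)).
pose t1 i : idx I + nat := match t i with inl _ => inl (f0 i) | inr k => inr k end.
apply: (@same_type_trans _ _ _ _ _ _ _ (block (sumf I e) t1)).
  apply: (same_type_set (same_type_trans h1 h2)) => [[x i]|]; last first.
    by move=> [[s b] Ab]; left.
  rewrite /block /t1 /=; case ti : (t i) => [j|k] /=.
    left; have zi : exists j, t i = inl j by exists j.
    exists (@tvar L (crep X Z) (x, exist _ i zi)); rewrite /= /block /=; split => //.
    by have := jzP (exist _ i zi); rewrite /= ti => -[->].
  by right; exists (e k x); split => //; right; exists k => //; exists x.
apply: (Ie q t1 t' _ it') => i j ij; have := it i j ij; rewrite /t1.
by case: (t i) => ?; case: (t j) => ? //= _; apply: f0i.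
Qed.

Definition put (n : nat) (a : 'I_n -> tup M X) (x : tup M X) : tup M (crep X 'I_n.+1) :=
  block (fun o : option 'I_n => if o is Some j then a j else x) (unlift ord_max).

Variables (dd : nat -> tup M X).
Hypothesis Idd : like (params A) (suml ltI ltn) (sumf I dd) ltI I.
Local Notation lt2 := (suml ltI ltn).
Local Notation I2 := (sumf I dd).

Let lto2 : stot lt2 := stot_suml ilt stot_ltn.
Let nl2 : no_last lt2.
Proof.
by move=> [i|k]; [exists (inr 0%N)|exists (inr k.+1) => /=].
Qed.
Let iO2 : inhabited (idx I + nat).
Proof. by constructor; right; exact: 0%N. Qed.

(** Two continuations of J are compared: e gives the value at z, and a realization of the average of
    J gives r. They agree because J eventually determines the formula. *)
Lemma Ev_value n (y : 'I_n -> idx I + nat) (z : 'I_n.+1 -> idx I)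
    (phi : lform (csum (crep X 'I_n.+1) (pctx A))) (r : R) :
  increasing (@ord_lt n) lt2 y -> increasing (@ord_lt n.+1) ltI z ->
  has_lim (fun i => feval phi (tsum (put (I2 \o y) (I i)) (params A))) r ->
  r = feval phi (tsum (block I z) (params A)).
Proof.
move=> iy iz Ir; pose f (x : tup M X) := feval phi (tsum (put (I2 \o y) x) (params A)).
have cf (B : set (elt M)) : A `<=` B -> (forall i, within B (I2 i)) -> cform (params B) f.
  move=> AB IB; apply: cform_set => -[[x i]|p].
    rewrite /= /put /block /=; case: (unlift ord_max i) => [j|].
      by right; exists (I2 (y j) x); split => //; apply: (IB (y j)).
    by left; exists (@tvar L X x).
  by right; exists (params A p); split => //; apply: AB; exact: within_params.
have [phi0 phi0P] := cf [set: elt M] (fun _ _ => Logic.I) (fun _ _ => Logic.I).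
have Ir0 : has_lim (fun i => feval phi0 (tsum (I i) (params [set: elt M]))) r.
  by move=> e /Ir[i iP]; exists i => j /iP; rewrite -phi0P.
have [J [sJ iJ [f0 [g0 [f0i g0i fg]]] [rJ detJ] Jr]] := Ev_witness Ir0.
have sXn : sm (var (crep X nat)) by apply: small_prod.
have [B1 sB1 B1P] := chain_stabilized HM sXn (lstp_chain HM HA sXn fg).
pose cI := comps (fun v : var (crep X (idx I)) => I v.2 v.1).
pose cd := comps (fun v : var (crep X nat) => dd v.2 v.1).
pose cJ := comps (fun v : var (crep X (idx J)) => J v.2 v.1).
(* B1 holds the indiscernible sequences that join the subsequences of I and J; dd is included
   because y may take entries from it. *)
pose B := A `|` cI `|` cd `|` cJ `|` B1.
have sB : small K B.
  by do !apply: small_setU => //; apply: small_image => //; apply: small_prod.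
have AB : A `<=` B by move=> a Aa; do 4!left.
have IB i : within B (I i) by move=> x; do 3!left; right; exists (x, i).
have dB i : within B (dd i) by move=> x; do 2!left; right; exists (x, i).
have JB i : within B (J i) by move=> x; left; right; exists (x, i).
have I2B i : within B (I2 i) by case: i.
have [e [Ie eB]] := morley_ext HM Hdep HA HX HIs HI sB AB IB.
set E := \bigcup_k comps (e k) in eB.
have iIJ : same_type (params (A `|` E)) (block I f0) (block J g0).
  by apply: B1P; apply: stabilizesS eB => a B1a; right.
have iJE : indiscernible (params (A `|` E)) (@idx_lt _ (idx J)) J.
  exact: (stabilized_indisc (@stot_idx _ (idx J)) (@idx_nolast _ J) (idx_inh J) eB iJ JB).
have Je := Ev_stabilized f0i g0i iIJ iJE Ie.
have i2 : indiscernible (params A) lt2 I2.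
  exact: like_indiscernible ilt (@idx_nolast _ I) (idx_inh I) Idd.
have i2E := stabilized_indisc lto2 nl2 iO2 eB i2 I2B.
pose wd (i : 'I_n) := widen_ord (leqnSn n) i.
have wdE j : lift ord_max j = wd j.
  by apply: val_inj; rewrite /= /bump leqNgt ltn_ord.
(* Since I followed by dd stays indiscernible over A and E, y may be replaced there by z without its
   last entry; then e k plays the role of that last entry. *)
have fe k : f (e k) = feval phi (tsum (block I z) (params A)).
  have iy' : increasing (@ord_lt n) lt2 (fun j => inl (z (wd j))).
    by move=> i j ij /=; apply: iz.
  have h := i2E n y (fun j => inl (z (wd j))) iy iy'.
  pose t1 (i : 'I_n.+1) : idx I + nat :=
    if unlift ord_max i is Some j then inl (z (wd j)) else inr k.
  suff : same_type (params A) (put (I2 \o y) (e k)) (block I z) by apply.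
  apply: (@same_type_trans _ _ _ _ _ _ _ (block (sumf I e) t1)).
    apply: (same_type_set h) => [[x i]|]; last by move=> [[s b] Ab]; left.
    rewrite /put /block /t1 /=; case: (unlift ord_max i) => [j|] /=.
      by left; exists (@tvar L (crep X 'I_n) (x, j)).
    by right; exists (e k x); split => //; right; exists k => //; exists x.
  apply: (Ie _ t1 z _ iz) => i j; rewrite /t1.
  case: (unliftP ord_max j) => [j'|] ->; case: (unliftP ord_max i) => [i'|] -> //=.
  - by rewrite !wdE => ij; apply: iz.
  - by rewrite wdE => ij; have := ltn_trans ij (ltn_ord j' : (wd j' < n)%N); rewrite ltnn.
  - by rewrite /ord_lt ltnn.
have det_lim (g : nat -> tup M X) v : continues (params A) J (nat_eseq g) ->
    (forall k, f (g k) = v) -> rJ = v.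
  move=> Jg fg'; have lg := detJ (nat_eseq g) Kn Jg.
  apply: (has_lim_uniq (inhabits 0%N) lg) => eps eps0; exists 0%N => j _.
  by rewrite /= -phi0P fg' subrr normr0.
have cont (g : nat -> tup M X) (O : Type) (lt : rel O) (a : O -> tup M X) :
    stot lt -> no_last lt -> inhabited O ->
    like (params A) (suml (@idx_lt _ (idx J)) ltn) (sumf J g) lt a ->
    continues (params A) J (nat_eseq g).
  move=> lto nl iO /(like_indiscernible lto nl iO) H q t u it iu.
  by apply: H => i j ij; [have := it _ _ ij|have := iu _ _ ij];
    rewrite /cat_lt; [case: (t i); case: (t j)|case: (u i); case: (u j)] => ? ? //=;
    rewrite ltEnat.
have <- : rJ = feval phi (tsum (block I z) (params A)).
  by apply: (det_lim e) => //; exact: (cont _ _ _ _ ilt (@idx_nolast _ I) (idx_inh I) Je).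
(* Determination is about continuations of J, whereas r is the limit along J itself; the average of
   J is therefore realized by a continuation g. *)
have [g [Jg fgr]] := avg_ext HM sX sB AB JB (@stot_idx _ (idx J)) (@idx_nolast _ J) (idx_inh J) iJ.
apply/esym; apply: (det_lim g).
  exact: (cont _ _ _ _ (@stot_idx _ (idx J)) (@idx_nolast _ J) (idx_inh J) Jg).
apply: fgr; first exact: cf.
move=> eps /Jr[i iP]; exists i => j /ltW/iP; by rewrite -phi0P.
Qed.

(* Moves the entry at position k to the end. *)
Definition rot_last n (k : 'I_n.+1) (i : 'I_n.+1) : 'I_n.+1 :=
  if unlift ord_max i is Some j then lift k j else k.

Lemma same_type_rot n (k : 'I_n.+1) (z : 'I_n.+1 -> idx I) :
  increasing (@ord_lt n.+1) ltI z ->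
  same_type (params A) (block I (z \o rot_last k)) (block I z).
Proof.
move=> iz phi.
(* Entries before position k stay in I and those after it go to dd. This leaves the place k vacant
   for an element of I beyond z. *)
pose y (j : 'I_n) : idx I + nat :=
  if (lift k j < k)%N then inl (z (lift k j)) else inr (nat_of_ord (lift k j)).
have iy : increasing (@ord_lt n) lt2 y.
  move=> i j ij; have h : (lift k i < lift k j)%N.
    by move: ij; rewrite /ord_lt /= /bump; case: leqP; case: leqP; lia.
  rewrite /y; case: ltnP => ik; case: ltnP => jk //=; first exact: iz.
  by have := leq_ltn_trans ik (ltn_trans h jk); rewrite ltnn.
(* It remains to see that the rotated tuple gives the limit along I; the value is in fact attained
   at every i above ub. *)
apply: (Ev_value iy iz) => e e0.
have [ub ubP] := ub_fin ilt (@idx_nolast _ I) (idx_inh I) z.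
exists ub => i ubi; set v := feval _ _; set v' := feval _ _.
suff -> : v = v' by rewrite subrr normr0.
pose z2 (l : 'I_n.+1) : idx I + nat :=
  if (l < k)%N then inl (z l) else if l == k then inl i else inr (nat_of_ord l).
have iz2 : increasing (@ord_lt n.+1) lt2 z2.
  move=> l m lm; have lm' : (l < m)%N by [].
  have zi l' : ltI (z l') i by exact: lt_le_trans (ubP l') ubi.
  rewrite /z2; case: (ltngtP m k) => mk; case: (ltngtP l k) => lk //=; rewrite -?val_eqE /=.
  - exact: iz.
  - lia.
  - lia.
  - by rewrite (gtn_eqF mk).
  - by rewrite (gtn_eqF mk) (gtn_eqF lk) /=.
  - by rewrite (gtn_eqF mk) lk eqxx.
  - by rewrite mk eqxx /=; exact: zi.
  - by rewrite mk eqxx; lia.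
  - lia.
have putE : put (I2 \o y) (I i) = block I2 (z2 \o rot_last k).
  apply/functional_extensionality_dep => -[x l]; rewrite /put /block /rot_last /=.
  case: (unlift ord_max l) => [j|]; rewrite /z2.
    by rewrite /y; case: ltnP => // _; rewrite eq_sym (negbTE (neq_lift k j)).
  by rewrite ltnn eqxx.
rewrite /v /v' putE.
suff : same_type (params A) (block I2 (z2 \o rot_last k)) (block I (z \o rot_last k)) by apply.
apply: (same_type_sub (Idd iz2 iz)) => [[x l]|p].
  by exists (@tvar L (csum (crep X 'I_n.+1) (pctx A)) (inl (x, rot_last k l))).
by exists (@tvar L (csum (crep X 'I_n.+1) (pctx A)) (inr p)).
Qed.

Definition Ity n (t : 'I_n -> idx I) : Prop := forall z : 'I_n -> idx I,
  increasing (@ord_lt n) ltI z -> same_type (params A) (block I t) (block I z).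

Lemma Ity_rot n (t : 'I_n.+1 -> idx I) (k : 'I_n.+1) : Ity t -> Ity (t \o rot_last k).
Proof.
move=> It z iz; apply: same_type_trans (same_type_rot k iz).
apply: (same_type_sub (It z iz)) => [[x l]|p].
  by exists (@tvar L (csum (crep X 'I_n.+1) (pctx A)) (inl (x, rot_last k l))).
by exists (@tvar L (csum (crep X 'I_n.+1) (pctx A)) (inr p)).
Qed.

Lemma nth_rot_last (T : Type) (x0 x : T) (u q : seq T) n (k i : 'I_n.+1) :
  size (u ++ x :: q) = n.+1 -> size u = k ->
  nth x0 (u ++ x :: q) (rot_last k i) = nth x0 (u ++ rcons q x) i.
Proof.
rewrite size_cat /= => sz uk.
rewrite /rot_last; case: (unliftP ord_max i) => [j|] -> /=; last first.
  rewrite !nth_cat uk ltnn subnn /= nth_rcons ifN; last by lia.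
  by rewrite ifN; [rewrite (_ : (n - k)%N = size q) ?eqxx//; lia|lia].
have jn := ltn_ord j.
have -> : bump n j = j by rewrite /bump leqNgt jn.
rewrite !nth_cat uk; case: (leqP k j) => kj.
  have -> : bump k j = j.+1 by rewrite /bump kj.
  rewrite ifN; last by lia.
  rewrite nth_rcons ifT; last by lia.
  by rewrite subSn.
have -> : bump k j = j by rewrite /bump leqNgt kj.
by rewrite kj.
Qed.

(** Sorting by moves to the end: the head of s is extracted from u and appended to p, until u is
    exhausted and the entries appear in the order of s. *)
Lemma Ity_perm n (i0 : idx I) (s u p : seq (idx I)) :
  perm_eq u s -> size (u ++ p) = n.+1 ->
  Ity (fun i : 'I_n.+1 => nth i0 (u ++ p) i) ->
  Ity (fun i : 'I_n.+1 => nth i0 (p ++ s) i).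
Proof.
elim: s u p => [|x s IH] u p us sz.
  by move/perm_nilP: us => -> /=; rewrite cats0.
have xu : x \in u by rewrite (perm_mem us) mem_head.
move: us sz; case/splitPr: xu => u1 u2 us sz It.
have kn : (size u1 < n.+1)%N by rewrite -sz !size_cat /=; lia.
have -> : p ++ x :: s = rcons p x ++ s by rewrite cat_rcons.
apply: (IH (u1 ++ u2)).
- by rewrite -(perm_cons x); move: us; rewrite (perm_catCA u1 [:: x] u2).
- by move: sz; rewrite !size_cat /= size_rcons; lia.
have := Ity_rot (Ordinal kn) It; rewrite /comp.
suff -> : (fun i : 'I_n.+1 => nth i0 ((u1 ++ x :: u2) ++ p) (rot_last (Ordinal kn) i)) =
    (fun i : 'I_n.+1 => nth i0 ((u1 ++ u2) ++ rcons p x) i) by [].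
apply/funext => i; rewrite -catA cat_cons nth_rot_last//.
  by rewrite -catA rcons_cat.
by rewrite -sz -catA.
Qed.

Lemma Ity_injective n (t : 'I_n -> idx I) : injective t -> Ity t.
Proof.
case: n t => [|n] t ti.
  move=> z _; apply: (same_type_sub (same_type_refl (params A) (block I t))) => [[x []]//|p].
  by exists (@tvar L (csum (crep X 'I_0) (pctx A)) (inr p)).
pose i0 := t ord0; pose l := [seq t i | i <- enum 'I_n.+1].
have szl : size l = n.+1 by rewrite size_map size_enum_ord.
have tl : t = (fun i : 'I_n.+1 => nth i0 ([::] ++ l) i).
  by apply/funext => i; rewrite cat0s (nth_map i) ?size_enum_ord// nth_ord_enum.
(* The sorted list satisfies [Ity] by indiscernibility, and rotations lead from it to l. *)
rewrite tl; pose u := sort <=%O l.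
have szu : size u = n.+1 by rewrite size_sort.
apply: (Ity_perm (u := u)); first by rewrite perm_sort.
  by rewrite cats0.
rewrite cats0 => z iz; apply: HI.1 iz => i j ij.
have su : sorted <%O u by rewrite sort_lt_sorted map_inj_uniq// enum_uniq.
rewrite /idx_lt; apply: (sorted_ltn_nth lt_trans i0 su) => //; rewrite inE szu//.
Qed.

End Symmetry.

Section SymmetryConclusion.
Variables (K : Type) (R : realType) (L : lang) (M : struct R L).
Hypotheses (HM : monster K M) (Hdep : dependent K M).
Variables (A : set (elt M)) (HA : small K A) (X : ctx L) (HX : fin_ctx X).
Variables (I : eseq (tup M X)) (HIs : small_seq K I) (HI : morley (params A) I).
Hypothesis HEv : Ev K A I = Av I [set: elt M].

Lemma Ev_symmetric n (t u : 'I_n -> idx I) :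
  injective t -> injective u -> same_type (params A) (block I t) (block I u).
Proof.
move=> ti ui.
have Kn := mon_nat HM; have Kp := mon_pow HM.
have sX := small_fin Kn HX.
pose B := A `|` comps (fun v : var (crep X (idx I)) => I v.2 v.1).
have sB : small K B.
  by apply: small_setU => //; apply: small_image => //; apply: small_prod.
have [dd [Idd _]] := @avg_ext K R L M HM A B X _ _ I sX sB
  (fun a Aa => or_introl Aa) (fun i x => or_intror (ex_intro2 _ _ (x, i) Logic.I erefl))
  (@stot_idx _ (idx I)) (@idx_nolast _ I) (idx_inh I) HI.1.
have [z iz] := inc_ord (@stot_idx _ (idx I)) (@idx_nolast _ I) (idx_inh I) n.
have H := Ity_injective HM Hdep HA HX HIs HI HEv Idd.
exact: same_type_trans (H _ _ ti z iz) (same_type_sym (H _ _ ui z iz)).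
Qed.

Lemma Ev_indisc_set : indisc_set I.
Proof.
split; first exact: indisc0 HI.1.
by move=> n t u ti ui; apply: same_type0 (Ev_symmetric ti ui).
Qed.

End SymmetryConclusion.

(** * The global average type *)

Section LargerMonster.
Variables (K : Type) (R : realType) (L : lang) (M : struct R L).
Hypothesis Hdep : dependent K M.
Variables (X : ctx L) (HX : fin_ctx X).
Variables (I : eseq (tup M X)) (HIs : small_seq K I) (HI : indisc_set I).
Variables (K1 : Type) (M1 : struct R L) (h : forall s, sdom M s -> sdom M1 s).
Hypotheses (HM1 : monster K1 M1) (Hel : elementary h) (HM : small K1 [set: elt M]).

Local Notation Pall := (pctx [set: elt M]).
Local Notation sm T := (small K1 [set: T]).

Let Kn := mon_nat HM1.
Let Kp := mon_pow HM1.
Let sX : sm (var X) := small_fin Kn HX.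
Let sP : sm (var Pall) := (small_setT K1 [set: elt M]).1 HM.

Let c1 : tup M1 Pall := fun e => h (params [set: elt M] e).
Let hI (i : idx I) : tup M1 X := fun x => h (I i x).
Let cvar s (b : sdom M s) : var Pall := exist _ (existT _ s b : elt M) Logic.I.

Let hIE (V : ctx L) (phi : lform V) (a : tup M V) :
  feval phi (fun v => h (a v) : sdom M1 _) = feval phi a.
Proof. exact: Hel. Qed.

(** An ultrafilter containing these sets concentrates on images of tuples of M, which makes its type
    a coheir over M. *)
Definition tails : set_system (tup M1 X) :=
  [set S | exists i : idx I, forall j, (i <= j)%O -> S (hI j)].

Lemma tails_filter : ProperFilter tails.
Proof.
split; first by move=> [i /(_ i (lexx i))].
split.
- by have [i] := idx_inh I; exists i.
- move=> S S' [i iS] [i' iS']; exists (Order.max i i') => j.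
  by rewrite ge_max => /andP[/iS ? /iS' ?].
- by move=> S S' SS' [i iS]; exists i => j /iS /SS'.
Qed.

Variables (W : set_system (tup M1 X)) (UW : UltraFilter W) (tW : tails `<=` W).
Variables (s : nat -> tup M1 X).
Hypothesis sW : forall k, ultra_real (tsum c1 (below s k)) W (s k).

Let FW := @ultra_proper _ W UW.

Let dclo_hI i : dclo c1 (hI i).
Proof.
move=> Y y y' yy'; apply: (same_type_sub yy') => [v|x].
  by exists (@tvar L (csum Y Pall) (inl v)).
by exists (@tvar L (csum Y Pall) (inr (cvar (I i x)))).
Qed.

Let W_dclo : W [set x | dclo c1 x].
Proof. by apply: tW; have [i] := idx_inh I; exists i => j _; exact: dclo_hI. Qed.

Let s_indisc : indiscernible c1 ltn s.
Proof. by have := coheir_indisc FW W_dclo sW. Qed.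

Let ultra_real_same_type (P : ctx L) (c : tup M1 P) (x y : tup M1 X) :
  ultra_real c W x -> ultra_real c W y -> same_type c x y.
Proof.
move=> cx cy phi; apply: eqr_eps => e e0; have e2 : 0 < e / 2 by lra.
have cf : cform c (fun x => feval phi (tsum x c)) by exists phi.
have [z [/= h1 h2]] := filter_ex (filterI (cx _ cf _ e2) (cy _ cf _ e2)).
by move: h1 h2; rewrite !ltr_norml => /andP[h1 h1'] /andP[h2 h2']; apply/andP; split; lra.
Qed.

(** A tuple z definable over c1 gives the same value to all terms of a c1-indiscernible sequence b_.
    As W concentrates on such z, a realization y of W over all of b_ satisfies every instance of a
    condition belonging to W, which therefore does not divide. *)
Lemma coheir_nonforking (P : ctx L) (c : tup M1 P) (x : tup M1 X) :
  sm (var P) -> ultra_real c W x -> ~ forks c1 c x.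
Proof.
move=> sPc cx [n [Y [phi [b [r [Yfin bdiv imp]]]]]].
(* Q gathers the parameters of all disjuncts, so that one realization a of W over c and Q selects a
   disjunct that holds in the type given by W. *)
pose Q := @Ctx L {k : 'I_n & var (Y k)} (fun v => vsort (projT2 v)).
pose bb : tup M1 Q := fun v => b (projT1 v) (projT2 v).
have sQ : sm (var Q).
  apply: small_fin => //; have -> : [set: var Q] = \bigcup_k (existT _ k @` [set: var (Y k)]).
    by apply/seteqP; split=> // -[k v] _; exists k => //; exists v.
  by apply: bigcup_finite => // k _; apply: finite_image; exact: Yfin.
have [a aW] := realize HM1 (tsum c bb) UW sX (small_sum Kn Kp sPc sQ).
have ca : ultra_real c W a.
  by apply: ultra_real_sub aW => p; exists (@tvar L (csum P Q) (inl p)).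
have [k kr] := imp a (ultra_real_same_type cx ca).
have [b_ [b0 bi bN]] := bdiv k.
have sYn : sm (var (crep (Y k) nat)).
  by apply: small_prod => //; apply: small_fin => //; exact: Yfin.
pose bs : tup M1 (crep (Y k) nat) := fun v => b_ v.2 v.1.
have [y yW] := realize HM1 bs UW sX sYn.
apply: bN; exists y => i; apply: le_trans kr.
suff -> : feval (phi k) (tsum y (b_ i)) = feval (phi k) (tsum a (b k)) by [].
have cfy : cform bs (fun x => feval (phi k) (tsum x (b_ i))).
  apply: cform_comp => -[v|v].
    by exists (@tvar L (csum X (crep (Y k) nat)) (inl v)).
  by exists (@tvar L (csum X (crep (Y k) nat)) (inr (v, i))).
have cfa : cform (tsum c bb) (fun x => feval (phi k) (tsum x (b k))).
  apply: cform_comp => -[v|v].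
    by exists (@tvar L (csum X (csum P Q)) (inl v)).
  by exists (@tvar L (csum X (csum P Q)) (inr (inr (existT _ k v)))).
apply: eqr_eps => e e0; have e2 : 0 < e / 2 by lra.
have [z [[/= h1 h2] h3]] := filter_ex (filterI (filterI (yW _ cfy _ e2) (aW _ cfa _ e2)) W_dclo).
have h4 : feval (phi k) (tsum z (b_ i)) = feval (phi k) (tsum z (b k)).
  pose sw : subst (csum X (Y k)) (csum (Y k) X) := fun w =>
    match w return lterm (csum (Y k) X) (vsort (c := csum X (Y k)) w) with
    | inl v => @tvar L (csum (Y k) X) (inr v) | inr v => @tvar L (csum (Y k) X) (inl v) end.
  have swE (v : tup M1 (Y k)) : feval (fsub (phi k) sw) (tsum v z) = feval (phi k) (tsum z v).
    rewrite feval_sub; congr feval.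
    by apply/functional_extensionality_dep => -[w|w].
  have := h3 _ _ _ (indisc_step i 0%N ltnn bi).
  by rewrite b0 => /(_ (fsub (phi k) sw)); rewrite !swE.
move: h1 h2; rewrite h4 !ltr_norml => /andP[h1 h1'] /andP[h2 h2'].
by apply/andP; split; lra.
Qed.

(* Entries of s are replaced one at a time by elements of I, the most recent ones
   first. *)
Let s_value N n (t : 'I_n -> idx I + nat) (u : 'I_n -> idx I)
    (phi : lform (csum (crep X 'I_n) ctx0)) :
  injective t -> (forall i k, t i = inr k -> (k < N)%N) -> injective u ->
  feval phi (tsum (block (sumf hI s) t) tup0) = feval phi (tsum (block I u) tup0).
Proof.
move=> ti tN ui; elim: N t ti tN => [|N IH] t ti tN.
  have Ht i : exists j, t i = inl j.
    by case ti' : (t i) => [j|k]; [exists j|have := tN _ _ ti'].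
  have [t0 t0P] := choice Ht.
  have t0i : injective t0 by move=> i j ij; apply: ti; rewrite !t0P ij.
  rewrite -(HI.2 n t0 u t0i ui phi) -hIE; congr feval.
  apply/functional_extensionality_dep => -[[x i]|[]].
  by rewrite /block /= t0P.
have [[p tp]|nt] := pselect (exists p, t p = inr N); last first.
  apply: IH => // i k ti'; have := tN _ _ ti'; rewrite ltnS leq_eqVlt => /orP[/eqP kN|//].
  by exfalso; apply: nt; exists i; rewrite ti' kN.
pose G (x : tup M1 X) : tup M1 (crep X 'I_n) :=
  block (fun q => if q == p then x else sumf hI s (t q)) id.
have tq q k : q != p -> t q = inr k -> (k < N)%N.
  move=> qp tk; have := tN _ _ tk; rewrite ltnS leq_eqVlt => /orP[/eqP kN|//].
  by case/eqP: qp; apply: ti; rewrite tk kN tp.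
have -> : block (sumf hI s) t = G (s N).
  apply/functional_extensionality_dep => -[x q]; rewrite /G /block /=.
  by case: eqP => [->|//]; rewrite tp.
apply: (ultra_real_const FW (@sW N) (f := fun x => feval phi (tsum (G x) tup0))).
  apply: cform_comp => -[[x q]|[]]; rewrite /= /G /block /=.
  case: eqP => [_|/eqP qp].
    by exists (@tvar L (csum X (csum Pall (crep X {j | (j < N)%N}))) (inl x)).
  case tqE : (t q) => [j|k] /=.
    by exists (@tvar L (csum X (csum Pall (crep X {j | (j < N)%N}))) (inr (inl (cvar (I j x))))).
  by exists (@tvar L (csum X (csum Pall (crep X {j | (j < N)%N})))
    (inr (inr (x, exist _ k (tq q k qp tqE))))).
move=> e e0; apply: tW; have [i0] := idx_inh I.
(* Above ub the index j differs from every index of I occurring in t, so the modified t' remains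
   injective. *)
have [ub ubP] := ub_fin (@stot_idx _ (idx I)) (@idx_nolast _ I) (idx_inh I)
  (fun q => if t q is inl j then j else i0).
exists ub => j ubj /=.
pose t' q := if q == p then inl j else t q.
have -> : G (hI j) = block (sumf hI s) t'.
  by apply/functional_extensionality_dep => -[x q]; rewrite /G /t' /block /=; case: eqP.
have tj q : t q <> inl j.
  by move=> tqj; have := ubP q; rewrite tqj /idx_lt => /lt_le_trans/(_ ubj); rewrite ltxx.
rewrite IH ?subrr ?normr0//.
  move=> q q'; rewrite /t'; case: eqP => [->|_]; case: eqP => [->|_] //.
  - by move/esym/tj.
  - by move/tj.
  - exact: ti.
by move=> q k; rewrite /t'; case: eqP => // /eqP qp; exact: tq.
Qed.

Lemma coheir_gen_stable : gen_stable K1 c1 (Av I [set: elt M]).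
Proof.
have ord_ltn m (t : 'I_m -> nat) : increasing (@ord_lt m) (@idx_lt _ nat) t ->
    increasing (@ord_lt m) ltn t.
  by move=> it i j ij; have := it i j ij; rewrite idx_ltn.
have sreal k : ultra_real c1 W (s k).
  apply: ultra_real_sub (@sW k) => p.
  by exists (@tvar L (csum Pall (crep X {j | (j < k)%N})) (inl p)).
exists (nat_eseq s); split.
- exact: Kn.
- split; first by move=> m t u /ord_ltn it /ord_ltn iu; exact: s_indisc.
  move=> i; apply: coheir_nonforking.
    by apply: small_sum => //; apply: small_prod => //; apply: small_sig.
  apply: ultra_real_sub (@sW i) => -[p|[x [j ji]]].
    by exists (@tvar L (csum Pall (crep X {j | (j < i)%N})) (inl p)).
  have ji' : (j < i)%N by move: ji; rewrite ltEnat.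
  by exists (@tvar L (csum Pall (crep X {j | (j < i)%N})) (inr (x, exist _ j ji'))).
- move=> i phi.
  (* [lim_end] defaults to 0, so dependence must first provide an actual limit. *)
  have [r rP] := dep_lim Hdep HX HIs HI.1 (c := params [set: elt M])
    (ex_intro _ phi (fun _ => erefl)).
  have -> : Av I [set: elt M] phi = r by exact: lim_endE (idx_inh I) rP.
  apply: (ultra_real_const FW (sreal i) (f := fun x => feval phi (tsum x c1))); first by exists phi.
  move=> e /rP[i0 i0P]; apply: tW; exists i0 => j /i0P.
  suff -> : feval phi (tsum (I j) (params [set: elt M])) = feval phi (tsum (hI j) c1) by [].
  rewrite -hIE; congr feval.
  by apply/functional_extensionality_dep => -[x|p].
split.
  by move=> m t u /ord_ltn it /ord_ltn iu; apply: same_type0 (s_indisc it iu).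
move=> n t u ti ui phi.
have [z iz] := inc_ord (@stot_idx _ (idx I)) (@idx_nolast _ I) (idx_inh I) n.
have zi : injective z.
  move=> i j ij; have [irr _ tot] := @stot_ord n.
  by case: (tot i j) => // /iz; rewrite ij /idx_lt ltxx.
have H (w : 'I_n -> nat) : injective w ->
    feval phi (tsum (block (nat_eseq s) w) tup0) = feval phi (tsum (block I z) tup0).
  move=> wi; have [N NP] := @ub_fin _ ltn stot_ltn (fun n => ex_intro _ n.+1 (ltnSn n))
    (inhabits 0%N) _ w.
  apply: (@s_value N n (fun i => inr (w i)) z) => //.
    by move=> i j [] /wi.
  by move=> i k [<-]; exact: NP.
by rewrite !H.
Qed.

End LargerMonster.

Theorem proposition3p8 (R : realType) (L : lang) (K : Type) (M : struct R L)
    (HM : monster K M) (Heq : has_eq M) (Hdep : dependent K M)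
    (A : set (elt M)) (HA : small K A)
    (X : ctx L) (HX : fin_ctx X)
    (I : eseq (tup M X)) (HIs : small_seq K I) (HI : morley (params A) I)
    (HEv : Ev K A I = Av I [set: elt M]) :
  [/\ gen_stable K (params A) (Av I A),
      (forall (K1 : Type) (M1 : struct R L) (h : forall s, sdom M s -> sdom M1 s),
         monster K1 M1 -> elementary h -> small K1 [set: elt M] ->
         gen_stable K1
           (fun e : var (pctx [set: elt M]) => h _ (params [set: elt M] e))
           (Av I [set: elt M]))
    & indisc_set I].
Proof.
have sI := Ev_indisc_set HM Hdep HA HX HIs HI HEv.
split=> //.
  (* I itself is the witness: by indiscernibility over A the values of a formula over A are constant
     along I, hence equal to their limit. *)
  exists I; split=> // i phi; apply/esym/lim_endE; first exact: idx_inh.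
  move=> e e0; exists i => j _.
  have irr : irreflexive (@idx_lt _ (idx I)) by case: (@stot_idx _ (idx I)).
  by rewrite (indisc_step j i irr HI.1) subrr normr0.
move=> K1 M1 h HM1 Hh sM.
have [W [UW tW]] := ultraFilterLemma (tails_filter I h).
have sX := small_fin (mon_nat HM1) HX.
have sP := (small_setT K1 [set: elt M]).1 sM.
have [s sW] := coheir_exists HM1
  (fun e : var (pctx [set: elt M]) => h _ (params [set: elt M] e)) UW sX sP.
exact: (coheir_gen_stable Hdep HX HIs sI HM1 Hh sM UW tW sW).
Qed.
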